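(* Let $Z\subset\mathbb{R}^d$ be a centrally symmetric convex body centered at the origin and let $m\ge 1$. Then $Z$ is an $m$-operanoid if and only if there exists a $d$-tuple of random matrices $A_1,\dots,A_d$ taking values in $\mathbb{H}^m$ with $\mathbb{E}\big[(\sum_{i=1}^d\|A_i\|_2^2)^{1/2}\big]<\infty$ such that \[h_Z(u)=\mathbb{E}\Big[\Big\|\sum_{i=1}^d u_iA_i\Big\|_1\Big]\quad\text{for all }u\in\mathbb{S}^{d-1}.\]
   Context: $\mathbb{H}^m$ denotes the real Euclidean space of complex Hermitian $m\times m$ matrices with inner product $\langle A,B\rangle=\mathrm{Re}\,\mathrm{tr}(AB)$; $\|A\|_2$ is the Frobenius norm and $\|A\|_1$ the trace (nuclear) norm, i.e. the sum of the absolute values of the eigenvalues of $A$. A convex body is a nonempty compact convex set. The support function of a convex body $K\subset\mathbb{R}^d$ is $h_K(u)=\max_{x\in K}\langle u,x\rangle$; the Hausdorff distance is $d_H(K,L)=\max_{u\in\mathbb{S}^{d-1}}|h_K(u)-h_L(u)|$. A convex body $K$ is centrally symmetric if $K-c=-(K-c)$ for some $c\in\mathbb{R}^d$. An $m$-operatope in $\mathbb{R}^d$ is a centrally symmetric convex body $Z$ whose support function has the form $h_Z(u)=\langle v,u\rangle+\sum_{j=1}^N\|\sum_{i=1}^d u_iA_i^{(j)}\|_1$ for some $N\ge1$, $v\in\mathbb{R}^d$ and matrices $A_i^{(j)}\in\mathbb{H}^m$ (equivalently, a finite Minkowski sum of affine images of the operator norm ball $B_\infty(\mathbb{H}^m)=\{A\in\mathbb{H}^m:\|A\|_{op}\le1\}$).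 An $m$-operanoid in $\mathbb{R}^d$ is a centrally symmetric convex body that is a limit, in the Hausdorff metric, of $m$-operatopes in $\mathbb{R}^d$. *)

(* Defs.v *)
From HB Require Import structures.
From mathcomp Require Import all_boot all_order all_algebra.
From mathcomp Require Import all_classical all_reals all_analysis.
From mathcomp Require Import complex.
Set Implicit Arguments. Unset Strict Implicit. Unset Printing Implicit Defensive.
Import Order.TTheory GRing.Theory Num.Theory.
Import numFieldNormedType.Exports.
Local Open Scope classical_set_scope.
Local Open Scope ring_scope.
Local Open Scope complex_scope.

Section Defs.
Variable R : realType.

Definition ip (d : nat) (u x : 'rV[R]_d) : R := \sum_(i < d) u 0 i * x 0 i.

Definition unit_sphere (d : nat) : set 'rV[R]_d :=
  [set u | \sum_(i < d) u 0 i ^+ 2 = 1].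


Definition convex_set_rV (d : nat) (K : set 'rV[R]_d) : Prop :=
  forall x y (t : R), K x -> K y -> 0 <= t -> t <= 1 ->
    K (t *: x + (1 - t) *: y).

Definition convex_body (d : nat) (K : set 'rV[R]_d) : Prop :=
  K !=set0 /\ compact K /\ convex_set_rV K.

Definition centrally_symmetric (d : nat) (K : set 'rV[R]_d) : Prop :=
  exists c : 'rV[R]_d, [set x - c | x in K] = [set - (x - c) | x in K].

Definition support_fun (d : nat) (K : set 'rV[R]_d) (u : 'rV[R]_d) : R :=
  sup [set ip u x | x in K].

Definition hausdorff_dist (d : nat) (K L : set 'rV[R]_d) : R :=
  sup [set `|support_fun K u - support_fun L u| | u in @unit_sphere d].

Definition hermitian (m : nat) (A : 'M[R[i]]_m) : Prop :=
  (map_mx Num.conj A)^T = A.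

(* trace norm: the sum of the absolute values of the eigenvalues of A,
   the eigenvalues (with multiplicity) being the real numbers e_1..e_m
   with char_poly A = prod (X - e_i).  Only meaningful for Hermitian A. *)
Definition trace_norm (m : nat) (A : 'M[R[i]]_m) : R :=
  xget 0 [set t | exists e : 'I_m -> R,
     char_poly A = \prod_(k < m) ('X - ((e k)%:C)%:P) /\
     t = \sum_(k < m) `|e k|].

Definition frob2 (m : nat) (A : 'M[R[i]]_m) : R := complex.Re (\tr (A *m A)).

Definition lincomb (d m : nat) (u : 'rV[R]_d) (A : 'I_d -> 'M[R[i]]_m) : 'M[R[i]]_m :=
  \sum_(i < d) ((u 0 i)%:C *: A i).

Definition operatope (m d : nat) (Z : set 'rV[R]_d) : Prop :=
  centrally_symmetric Z /\ convex_body Z /\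
  exists (N : nat) (v : 'rV[R]_d) (A : 'I_N -> 'I_d -> 'M[R[i]]_m),
    (0 < N)%N /\ (forall j i, hermitian (A j i)) /\
    forall u : 'rV[R]_d,
      support_fun Z u = ip v u + \sum_(j < N) trace_norm (lincomb u (A j)).

Definition operanoid (m d : nat) (Z : set 'rV[R]_d) : Prop :=
  centrally_symmetric Z /\ convex_body Z /\
  exists Zs : nat -> set 'rV[R]_d,
    (forall n, operatope m (Zs n)) /\
    (fun n => hausdorff_dist (Zs n) Z) @ \oo --> (0 : R).

Definition random_hermitian_tuple (dsp : measure_display) (Omega : measurableType dsp)
    (d m : nat) (A : 'I_d -> Omega -> 'M[R[i]]_m) : Prop :=
  (forall i w, hermitian (A i w)) /\
  (forall i j k, measurable_fun setT (fun w => complex.Re (A i w j k)) /\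
                 measurable_fun setT (fun w => complex.Im (A i w j k))).

End Defs.
Arguments unit_sphere {R} d.

(* Main.v *)
Require Import Defs.
From HB Require Import structures.
From mathcomp Require Import all_boot all_order all_algebra.
From mathcomp Require Import all_classical all_reals all_analysis.
From mathcomp Require Import measurable_realfun complex.
From mathcomp Require Import ring lra.
Import Order.TTheory GRing.Theory Num.Theory.
Import numFieldNormedType.Exports.
Local Open Scope classical_set_scope.
Local Open Scope ring_scope.

(** If A has spectral decomposition U* diag(e) U, then X = U* diag(sg e) U
    satisfies Re tr(A X) = ||A||_1 and Re tr(B X) <= ||B||_1 for every Hermitian
    B.  Such subgradients show that u |-> sum_j ||sum_i u_i A_i^(j)||_1 is the
    support function of {x | <u, x> <= h(u) for all u}, with no appeal to a
    separation theorem, and that u |-> ||sum_i u_i A_i||_1 is Lipschitz in the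
    real coordinates of A, uniformly over the unit sphere.

    From a random tuple to an operanoid: approximate the coordinates in L^1 by
    simple functions; each approximation has finite support, hence is an
    operatope, and the Lipschitz bound makes the support functions converge
    uniformly on the sphere.

    From an operanoid to a random tuple: after symmetrization, the support
    function of an approximating operatope is the expectation of
    ||sum_i u_i A_i||_1 under a finitely supported law.  Pairing the sums with
    the basis vectors bounds the total mass, so all these laws can be put on a
    common box.  Instead of quoting Prokhorov's theorem, a limit law is built as
    the law of an explicit function on [0, 1): refine the box by nested finite
    grids whose cells are numbered lexicographically, take limits along an
    ultrafilter of the cumulated masses of the cells, and send a point of [0, 1)
    to the intersection of the nested cells in whose mass intervals it lies.
    Points with equal codes are close, so it is harmless that the limit may put
    mass on cell boundaries. *)

(** * The trace norm of Hermitian matrices *)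

Section TraceNorm.
Set Implicit Arguments. Unset Strict Implicit. Unset Printing Implicit Defensive.
Local Open Scope complex_scope.
Variables (R : realType) (m : nat).
Implicit Types (A B U V : 'M[R[i]]_m) (e f : 'I_m -> R).

Definition rdiag e : 'M[R[i]]_m := diag_mx (\row_k (e k)%:C).
Definition adjmx A : 'M[R[i]]_m := (map_mx Num.conj A)^T.

Lemma adjmxK A : adjmx (adjmx A) = A.
Proof. by apply/matrixP => i j; rewrite !mxE conjCK. Qed.

Lemma adjmxM A B : adjmx (A *m B) = adjmx B *m adjmx A.
Proof. by rewrite /adjmx map_mxM trmx_mul. Qed.

Lemma Re_mulrC (x : R) (z : R[i]) : complex.Re (x%:C * z) = x * complex.Re z.
Proof. by case: z => a b /=; rewrite mul0r subr0. Qed.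

Lemma Re_sum (I : Type) (r : seq I) (P : pred I) (F : I -> R[i]) :
  complex.Re (\sum_(i <- r | P i) F i) = \sum_(i <- r | P i) complex.Re (F i).
Proof.
exact: (@big_morph _ _ _ 0 +%R 0 +%R (@raddfD _ _ (@complex.Re R : Rcomplex R -> R))).
Qed.

Lemma hermitian_spectralP A : Defs.hermitian A ->
  exists U e, [/\ adjmx U *m U = 1%:M, U *m adjmx U = 1%:M &
    A = adjmx U *m rdiag e *m U].
Proof.
move=> hA.
have hs : A \is sesquilinear.hermitianmx m false Num.conj.
  by apply/sesquilinear.is_hermitianmxP; rewrite expr0 scale1r -{1}hA map_trmx.
have := hermitian_spectral_diag_real hs.
have /hermitian_normalmx /orthomx_spectralP := hs.
have Uu := spectral_unitarymx A.
have Un := unitarymx_unit Uu.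
have iU : invmx (spectralmx A) = adjmx (spectralmx A).
  by rewrite invmx_unitary // /adjmx map_trmx.
move=> eA rd; exists (spectralmx A), (fun k => complex.Re (spectral_diag A 0 k)).
split; [by rewrite -iU mulVmx|by rewrite -iU mulmxV|].
rewrite -iU {1}eA; congr (_ *m diag_mx _ *m _).
apply/rowP => k; rewrite mxE; apply/esym/RRe_real.
by move/mxOverP: rd; apply.
Qed.

Lemma char_poly_unitary_conj U e : adjmx U *m U = 1%:M ->
  char_poly (adjmx U *m rdiag e *m U) = \prod_(k < m) ('X - ((e k)%:C)%:P).
Proof.
move=> UU.
have -> : \prod_(k < m) ('X - ((e k)%:C)%:P) = char_poly (rdiag e).
  rewrite char_poly_trig ?diag_mx_is_trig//; apply: eq_bigr => k _.
  by rewrite !mxE eqxx mulr1n.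
rewrite /char_poly /char_poly_mx !map_mxM.
have PP : map_mx polyC (adjmx U) *m map_mx polyC U = 1%:M.
  by rewrite -map_mxM UU map_mx1.
(* The scalar matrix ['X%:M] commutes with everything, so it is its own conjugate by [U] and the
   conjugation factors out of the determinant. *)
have eX : 'X%:M = map_mx polyC (adjmx U) *m 'X%:M *m map_mx polyC U :> 'M[{poly R[i]}]_m.
  by rewrite scalar_mxC -mulmxA PP mulmx1.
rewrite [in LHS]eX -mulmxBl -mulmxBr !det_mulmx mulrAC -det_mulmx PP det1 mul1r //.
Qed.

(** The characteristic polynomial determines its roots up to permutation, so the choice made in
    [trace_norm] is forced and any unitary diagonalization computes it. *)
Lemma trace_normE A U e : adjmx U *m U = 1%:M -> A = adjmx U *m rdiag e *m U ->
  trace_norm A = \sum_(k < m) `|e k|.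
Proof.
move=> UU ->; have cp := char_poly_unitary_conj e UU.
apply: xget_unique; first by exists e.
move=> _ [f [cf ->]].
have pe : perm_eq [seq (f k)%:C | k <- index_enum 'I_m]
                  [seq (e k)%:C | k <- index_enum 'I_m].
  by apply: prod_XsubC_eq; rewrite !big_map -cp cf.
have := perm_big _ pe (P := xpredT) (F := fun z : R[i] => `|complex.Re z|)
   (op := +%R) (x := 0).
by rewrite !big_map.
Qed.

(** Cyclicity of the trace leaves only the change of basis [U *m adjmx V], whose entries enter
    through their squared moduli. *)
Lemma Re_mxtrace_spectral U V e f :
  complex.Re (\tr (adjmx U *m rdiag e *m U *m (adjmx V *m rdiag f *m V))) =
  \sum_(k < m) \sum_(l < m)
    e k * (f l * complex.Re ((U *m adjmx V) k l * Num.conj ((U *m adjmx V) k l))).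
Proof.
have -> : \tr (adjmx U *m rdiag e *m U *m (adjmx V *m rdiag f *m V)) =
  \tr (rdiag e *m ((U *m adjmx V) *m (rdiag f *m (V *m adjmx U)))).
  by rewrite -[in LHS]mulmxA -[in LHS]mulmxA mxtrace_mulC !mulmxA.
have -> : V *m adjmx U = adjmx (U *m adjmx V).
  by rewrite adjmxM adjmxK.
move: (U *m adjmx V) => W.
rewrite /mxtrace Re_sum; apply: eq_bigr => k _.
rewrite mul_diag_mx !mxE Re_mulrC Re_sum mulr_sumr; apply: eq_bigr => l _.
by rewrite mul_diag_mx !mxE mulrCA Re_mulrC.
Qed.

Lemma Re_mxtrace_spectral_diag U e f : U *m adjmx U = 1%:M ->
  complex.Re (\tr (adjmx U *m rdiag e *m U *m (adjmx U *m rdiag f *m U))) =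
  \sum_(k < m) e k * f k.
Proof.
move=> UU; rewrite Re_mxtrace_spectral UU.
apply: eq_bigr => k _; rewrite (bigD1 k) //= big1 ?addr0.
  by rewrite !mxE eqxx conjC1 !mulr1.
by move=> l /negPf lk; rewrite !mxE eq_sym lk mul0r !mulr0.
Qed.

Lemma Re_mul_conj_ge0 (z : R[i]) : 0 <= complex.Re (z * Num.conj z).
Proof. by case: z => a b /=; rewrite mulrN opprK addr_ge0 // -expr2 sqr_ge0. Qed.

Lemma unitary_row U : U *m adjmx U = 1%:M ->
  forall k, \sum_(l < m) complex.Re (U k l * Num.conj (U k l)) = 1.
Proof.
move=> UU k; have := congr1 (fun M : 'M[R[i]]_m => complex.Re (M k k)) UU.
rewrite !mxE eqxx Re_sum => /= <-.
by apply: eq_bigr => l _; rewrite !mxE.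
Qed.

(** [X] is the sign matrix of [A]. For [B] with eigenvalues [f], [Re tr (B X)] weighs the products
    of [f k] and signs by the squared moduli of the entries of a unitary matrix; each row of weights
    sums to 1, so the total is at most the sum of the [|f k|]. *)
Lemma trace_norm_subgradient A : Defs.hermitian A -> exists X : 'M[R[i]]_m,
  complex.Re (\tr (A *m X)) = trace_norm A /\
  forall B, Defs.hermitian B -> complex.Re (\tr (B *m X)) <= trace_norm B.
Proof.
move=> /hermitian_spectralP[U [e [UU UU' eA]]].
exists (adjmx U *m rdiag (fun k => Num.sg (e k)) *m U); split.
  rewrite (trace_normE UU eA) eA Re_mxtrace_spectral_diag //.
  by apply: eq_bigr => k _; rewrite normrEsg mulrC.
move=> _ /hermitian_spectralP[V [f [VV VV' ->]]].
rewrite (trace_normE VV erefl) Re_mxtrace_spectral.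
set W := V *m adjmx U.
have WW : W *m adjmx W = 1%:M.
  by rewrite /W adjmxM adjmxK mulmxA -(mulmxA V) UU mulmx1 VV'.
apply: ler_sum => k _.
rewrite -mulr_sumr -[leRHS]mulr1 -(unitary_row WW k).
rewrite (le_trans (ler_norm _)) // normrM ler_wpM2l //.
rewrite (le_trans (ler_norm_sum _ _ _)) // ler_sum // => l _.
rewrite normrM (ger0_norm (Re_mul_conj_ge0 _)) ler_piMl ?Re_mul_conj_ge0 //.
by rewrite normr_sg lern1 leq_b1.
Qed.

Lemma trace_norm_ge0 A : 0 <= trace_norm A.
Proof.
(* When no real factorization exists, [xget] returns the default 0. *)
rewrite /trace_norm; case: xgetP => [t _ [e [_ ->]]|//].
by rewrite sumr_ge0.
Qed.

(** Both quantities are read off the eigenvalues. Bounding every [|e k|] by the l2 norm gives the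
    crude factor [m^2], which is enough for a Lipschitz constant. *)
Lemma frob2_trace_norm A : Defs.hermitian A ->
  frob2 A <= trace_norm A ^+ 2 /\ trace_norm A ^+ 2 <= (m%:R ^+ 2) * frob2 A.
Proof.
move=> /hermitian_spectralP[U [e [UU UU' eA]]].
have -> : frob2 A = \sum_k e k ^+ 2.
  by rewrite /frob2 eA Re_mxtrace_spectral_diag.
rewrite (trace_normE UU eA).
have le1 k : `|e k| <= \sum_k `|e k|.
  by rewrite (bigD1 k) //= lerDl sumr_ge0.
split.
  rewrite expr2 mulr_suml; apply: ler_sum => k _.
  by rewrite -real_normK ?num_real // expr2 ler_wpM2l.
rewrite -ler_sqrt ?mulr_ge0 ?sqr_ge0 ?sumr_ge0 // => [|k _]; last exact: sqr_ge0.
rewrite sqrtr_sqr sqrtrM ?sqr_ge0 // sqrtr_sqr normr_nat.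
rewrite ger0_norm ?sumr_ge0 //.
rewrite (_ : m%:R * _ = \sum_(k < m) Num.sqrt (\sum_k e k ^+ 2)); last first.
  by rewrite sumr_const card_ord mulr_natl.
apply: ler_sum => k _; rewrite -sqrtr_sqr ler_sqrt.
  by rewrite (bigD1 k) //= lerDl sumr_ge0 // => l _; rewrite sqr_ge0.
by rewrite sumr_ge0 // => l _; rewrite sqr_ge0.
Qed.

End TraceNorm.

(** * Subadditivity of the trace norm and entrywise bounds *)

Section TraceNormSubadditive.
Set Implicit Arguments. Unset Strict Implicit. Unset Printing Implicit Defensive.
Local Open Scope complex_scope.
Variables (R : realType) (m : nat).
Implicit Types (A B : 'M[R[i]]_m).

Lemma hermitian_entry A : Defs.hermitian A -> forall j k, A k j = Num.conj (A j k).
Proof. by move=> hA j k; rewrite -{1}hA !mxE. Qed.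

Lemma hermitianD A B : Defs.hermitian A -> Defs.hermitian B -> Defs.hermitian (A + B).
Proof. by move=> hA hB; rewrite /Defs.hermitian map_mxD linearD /= hA hB. Qed.

Lemma hermitian0 : Defs.hermitian (0 : 'M[R[i]]_m).
Proof. by rewrite /Defs.hermitian map_mx0 trmx0. Qed.

Lemma hermitianZ (c : R) A : Defs.hermitian A -> Defs.hermitian (c%:C *: A).
Proof.
move=> hA; apply/matrixP => j k; rewrite !mxE (hermitian_entry hA k j).
by rewrite (rmorphM Num.conj); congr (_ * _); exact: conjc_real.
Qed.

Lemma trace_normZ (c : R) A : Defs.hermitian A ->
  trace_norm (c%:C *: A) = `|c| * trace_norm A.
Proof.
move=> /hermitian_spectralP[U [e [UU _ eA]]].
rewrite (trace_normE UU eA) (@trace_normE _ _ _ U (fun k => c * e k) UU).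
  by rewrite mulr_sumr; apply: eq_bigr => k _; rewrite normrM.
rewrite eA scalemxAl scalemxAr; congr (_ *m _ *m _); apply/matrixP => j k; rewrite !mxE mulrnAr.
by congr (_ *+ _); rewrite rmorphM.
Qed.

Lemma Re_mxtraceD A B X : complex.Re (\tr ((A + B) *m X)) =
  complex.Re (\tr (A *m X)) + complex.Re (\tr (B *m X)).
Proof. by rewrite mulmxDl mxtraceD raddfD. Qed.

(** Pairing with the subgradient at [A + B] is linear, so it splits over the two terms. *)
Lemma ler_trace_normD A B : Defs.hermitian A -> Defs.hermitian B ->
  trace_norm (A + B) <= trace_norm A + trace_norm B.
Proof.
move=> hA hB; have [X [<- sub]] := trace_norm_subgradient (hermitianD hA hB).
by rewrite Re_mxtraceD lerD // sub.
Qed.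

Lemma trace_norm0 : trace_norm (0 : 'M[R[i]]_m) = 0.
Proof.
by have := trace_normZ 0 hermitian0; rewrite scaler0 normr0 mul0r.
Qed.

Lemma ler_trace_norm_sum (I : Type) (r : seq I) (F : I -> 'M[R[i]]_m) :
  (forall i, Defs.hermitian (F i)) ->
  Defs.hermitian (\sum_(i <- r) F i) /\
  trace_norm (\sum_(i <- r) F i) <= \sum_(i <- r) trace_norm (F i).
Proof.
move=> hF; elim: r => [|x r [hr IH]].
  by rewrite !big_nil trace_norm0; split => //; exact: hermitian0.
rewrite !big_cons; split; first exact: hermitianD.
by rewrite (le_trans (ler_trace_normD _ _)) // lerD2l.
Qed.

Lemma frob2E A : Defs.hermitian A ->
  frob2 A = \sum_j \sum_k (complex.Re (A j k) ^+ 2 + complex.Im (A j k) ^+ 2).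
Proof.
move=> hA; rewrite /frob2 /mxtrace Re_sum; apply: eq_bigr => j _.
rewrite mxE Re_sum; apply: eq_bigr => k _.
rewrite (hermitian_entry hA j k); case: (A j k) => a b /=.
by rewrite mulrN opprK -!expr2.
Qed.

Lemma frob2_ge_entry A : Defs.hermitian A -> forall j k,
  complex.Re (A j k) ^+ 2 + complex.Im (A j k) ^+ 2 <= frob2 A.
Proof.
move=> hA j k; rewrite (frob2E hA) (bigD1 j) //= (bigD1 k) //= -addrA lerDl.
rewrite addr_ge0 ?sumr_ge0 // => *; rewrite ?sumr_ge0 // => *;
by rewrite addr_ge0 ?sqr_ge0.
Qed.

Lemma frob2_ge0 A : Defs.hermitian A -> 0 <= frob2 A.
Proof.
move=> hA; rewrite (frob2E hA) sumr_ge0 // => *; rewrite sumr_ge0 // => *.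
by rewrite addr_ge0 ?sqr_ge0.
Qed.

End TraceNormSubadditive.

(** * Real coordinates of Hermitian tuples and the Lipschitz bound *)

Section Coordinates.
Set Implicit Arguments. Unset Strict Implicit. Unset Printing Implicit Defensive.
Local Open Scope complex_scope.
Variables (R : realType) (d m : nat).
Implicit Types (u : 'rV[R]_d).

(** The Boolean selects the real part ([true]) or the imaginary part ([false]). Mirrored entries
    have separate coordinates, so that the full space [coord -> R] can be used without
    constraints. *)
Definition coord := ('I_d * 'I_m * 'I_m * bool)%type.
Implicit Types (a b : coord -> R) (A : 'I_d -> 'M[R[i]]_m).

Definition coord_of A (x : coord) : R :=
  let: (i, j, k, b) := x in
  if b then complex.Re (A i j k) else complex.Im (A i j k).

(* Symmetrizing makes this Hermitian-valued on all of [coord -> R]. *)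
Definition herm_of a (i : 'I_d) : 'M[R[i]]_m :=
  \matrix_(j, k) (((a (i, j, k, true) + a (i, k, j, true)) / 2) +i*
                  ((a (i, j, k, false) - a (i, k, j, false)) / 2)).

(** A seminorm in [a] on a finite-dimensional real space; all approximation and limit arguments are
    applied to these test functions. *)
Definition tnorm u a : R := trace_norm (lincomb u (herm_of a)).

Lemma herm_of_hermitian a i : Defs.hermitian (herm_of a i).
Proof.
apply/matrixP => j k; rewrite !mxE /=; apply/eqP; rewrite eq_complex /=.
by rewrite addrC eqxx -mulNr opprB eqxx.
Qed.

Lemma coord_ofK A : (forall i, Defs.hermitian (A i)) -> herm_of (coord_of A) = A.
Proof.
move=> hA; apply/funext => i; apply/matrixP => j k; rewrite !mxE /=.
rewrite (hermitian_entry (hA i) j k); case: (A i j k) => x y /=.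
by congr (_ +i* _); rewrite ?opprK; field.
Qed.

Lemma lincomb_trace_norm u A : (forall i, Defs.hermitian (A i)) ->
  Defs.hermitian (lincomb u A) /\
  trace_norm (lincomb u A) <= \sum_i `|u 0 i| * trace_norm (A i).
Proof.
move=> hA; have [h le] := @ler_trace_norm_sum R m _ (index_enum 'I_d)
  (fun i => (u 0 i)%:C *: A i) (fun i => hermitianZ _ (hA i)).
split => //; apply: (le_trans le); apply: ler_sum => i _.
by rewrite trace_normZ.
Qed.

Lemma lincomb_hermitian u A : (forall i, Defs.hermitian (A i)) ->
  Defs.hermitian (lincomb u A).
Proof. by move=> /(lincomb_trace_norm u)[]. Qed.

Lemma tnorm_ge0 u a : 0 <= tnorm u a.
Proof. exact: trace_norm_ge0. Qed.

Lemma lincomb_herm_ofD u a b : lincomb u (herm_of (fun x => a x + b x)) =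
  lincomb u (herm_of a) + lincomb u (herm_of b).
Proof.
rewrite /lincomb -big_split /=; apply: eq_bigr => i _.
rewrite -scalerDr; congr (_ *: _); apply/matrixP => j k; rewrite !mxE.
by apply/eqP; rewrite eq_complex /=; apply/andP; split; apply/eqP; field.
Qed.

Lemma lincomb_herm_ofZ u (c : R) a :
  lincomb u (herm_of (fun x => c * a x)) = c%:C *: lincomb u (herm_of a).
Proof.
rewrite /lincomb scaler_sumr; apply: eq_bigr => i _.
rewrite scalerA mulrC -scalerA; congr (_ *: _); apply/matrixP => j k; rewrite !mxE.
by apply/eqP; rewrite eq_complex /=; apply/andP; split; apply/eqP; field.
Qed.

Lemma tnormZ u (c : R) a : tnorm u (fun x => c * a x) = `|c| * tnorm u a.
Proof.
rewrite /tnorm lincomb_herm_ofZ trace_normZ //.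
exact/lincomb_hermitian/herm_of_hermitian.
Qed.

Lemma ler_tnormD u a b : tnorm u (fun x => a x + b x) <= tnorm u a + tnorm u b.
Proof.
rewrite /tnorm lincomb_herm_ofD.
by apply: ler_trace_normD; exact/lincomb_hermitian/herm_of_hermitian.
Qed.

Lemma ler_coord_trace_norm A : (forall i, Defs.hermitian (A i)) ->
  forall i j k (r : bool), `|coord_of A (i, j, k, r)| <= trace_norm (A i).
Proof.
move=> hA i j k r; have [le _] := frob2_trace_norm (hA i).
rewrite -(@ler_pXn2r _ 2) ?nnegrE ?trace_norm_ge0 // real_normK ?num_real //.
rewrite (le_trans _ le) // (le_trans _ (frob2_ge_entry (hA i) j k)) //=.
by case: r; rewrite ?lerDl ?lerDr sqr_ge0.
Qed.

Lemma unit_sphere_le1 u : unit_sphere d u -> forall i, `|u 0 i| <= 1.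
Proof.
move=> su i; rewrite -(@ler_pXn2r _ 2) ?nnegrE // expr1n real_normK ?num_real //.
by rewrite -su (bigD1 i) //= lerDl sumr_ge0 // => *; rewrite sqr_ge0.
Qed.

(** For each [i], the factor [m] compares trace and Frobenius norms, and [2 * m] bounds the
    Frobenius norm of an [m] by [m] matrix by its largest coordinate, with 2 in place of the square
    root of 2. *)
Definition lip_cst : R := \sum_(i < d) (m%:R * (2 * m%:R)).

Lemma ler_tnorm_l1 u a : unit_sphere d u -> tnorm u a <= lip_cst * \sum_x `|a x|.
Proof.
move=> su; have hh := herm_of_hermitian a; set S := \sum_x _.
have S0 : 0 <= S by exact: sumr_ge0.
rewrite (le_trans (lincomb_trace_norm u hh).2) // /lip_cst mulr_suml.
apply: ler_sum => i _; apply: (@le_trans _ _ (trace_norm (herm_of a i))).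
  by rewrite ler_piMl ?trace_norm_ge0 // unit_sphere_le1.
rewrite -(@ler_pXn2r _ 2) ?nnegrE ?trace_norm_ge0 //; last first.
  by rewrite !mulr_ge0 ?ler0n.
have [_ le] := frob2_trace_norm (hh i).
rewrite (le_trans le) // -mulrA [leRHS]exprMn ler_wpM2l ?sqr_ge0 //.
have aS x : `|a x| <= S by rewrite /S (bigD1 x) //= lerDl sumr_ge0.
have aS2 x y : ((a x + a y) / 2) ^+ 2 <= S ^+ 2 /\ ((a x - a y) / 2) ^+ 2 <= S ^+ 2.
  have sq z : `|z| <= S -> z ^+ 2 <= S ^+ 2.
    by move=> zS; rewrite -(real_normK (num_real z)) ler_pXn2r ?nnegrE.
  have := aS x; have := aS y; rewrite !ler_norml => /andP[? ?] /andP[? ?].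
  by split; apply: sq; rewrite ler_norml; apply/andP; split; lra.
rewrite (frob2E (hh i)).
apply: (@le_trans _ _ (\sum_(j < m) \sum_(k < m) (S ^+ 2 + S ^+ 2))).
  apply: ler_sum => j _; apply: ler_sum => k _; rewrite !mxE /= lerD //.
    exact: (aS2 _ _).1.
  exact: (aS2 _ _).2.
rewrite !sumr_const !card_ord.
rewrite [leLHS](_ : _ = 2 * (m%:R * S) ^+ 2); last by ring.
rewrite [leRHS](_ : _ = 4 * (m%:R * S) ^+ 2); last by ring.
by rewrite ler_wpM2r ?sqr_ge0 // ler_nat.
Qed.

Lemma tnorm_lipschitz u a b : unit_sphere d u ->
  `|tnorm u a - tnorm u b| <= lip_cst * \sum_x `|a x - b x|.
Proof.
move=> su.
have h a' b' : tnorm u a' - tnorm u b' <= lip_cst * \sum_x `|a' x - b' x|.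
  have {1}-> : a' = (fun x => (a' x - b' x) + b' x) by apply/funext => x; rewrite subrK.
  by rewrite lerBlDr (le_trans (ler_tnormD _ _ _)) // lerD2r ler_tnorm_l1.
rewrite ler_norml h andbT lerNl opprB.
under [X in _ * X]eq_bigr do rewrite distrC.
exact: h.
Qed.

End Coordinates.

(** * Support functions and operatopes *)

Section SupportFunctions.
Set Implicit Arguments. Unset Strict Implicit. Unset Printing Implicit Defensive.
Variables (R : realType) (d : nat).
Implicit Types (u x : 'rV[R]_d) (K L : set 'rV[R]_d) (h : 'rV[R]_d -> R).

Lemma ipN u x : ip u (- x) = - ip u x.
Proof. by rewrite /ip -sumrN; apply: eq_bigr => i _; rewrite mxE mulrN. Qed.

Lemma ipNl u x : ip (- u) x = - ip u x.
Proof. by rewrite /ip -sumrN; apply: eq_bigr => i _; rewrite mxE mulNr. Qed.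

Lemma ipDZ u x y (s t : R) : ip u (s *: x + t *: y) = s * ip u x + t * ip u y.
Proof.
rewrite /ip !mulr_sumr -big_split /=; apply: eq_bigr => i _.
by rewrite !mxE; ring.
Qed.

Lemma ip_delta i x : ip (delta_mx 0 i) x = x 0 i.
Proof.
rewrite /ip (bigD1 i) //= big1 ?addr0; first by rewrite mxE !eqxx mul1r.
by move=> j /negPf ji; rewrite mxE eqxx ji mul0r.
Qed.

Lemma delta_unit_sphere (i : 'I_d) : unit_sphere d (delta_mx 0 i : 'rV[R]_d).
Proof.
rewrite /unit_sphere /= (bigD1 i) //= big1 ?addr0.
  by rewrite mxE !eqxx expr1n.
by move=> j /negPf ji; rewrite mxE eqxx ji expr0n.
Qed.

Lemma unit_sphereN u : unit_sphere d u -> unit_sphere d (- u).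
Proof.
by rewrite /unit_sphere /= => <-; apply: eq_bigr => i _; rewrite mxE sqrrN.
Qed.

Lemma ip_continuous u : continuous (ip u).
Proof.
have ci i : continuous (fun y : 'rV[R]_d => u 0 i * y 0 i).
  move=> y; apply: (@continuous_comp _ _ _ (fun y : 'rV[R]_d => y 0 i) ( *%R (u 0 i))).
    exact: coord_continuous.
  exact: mulrl_continuous.
rewrite /ip; elim: (index_enum _) => [|i r IH].
  under eq_fun do rewrite big_nil; exact: cst_continuous.
under eq_fun do rewrite big_cons.
by move=> x; exact: (continuousD (ci i x) (IH x)).
Qed.

Lemma compact_coord_bounded K : compact K ->
  exists2 M, 0 <= M & forall x, K x -> forall i, `|x 0 i| <= M.
Proof.
move=> cK.
have bnd i : exists M : R, 0 <= M /\ forall x, K x -> `|x 0 i| <= M.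
  have /compact_bounded[M [_ MK]] : compact ((fun x : 'rV[R]_d => x 0 i) @` K).
    apply: continuous_compact => //; apply: continuous_subspaceT.
    exact: coord_continuous.
  exists (`|M| + 1); split; first by rewrite addr_ge0.
  move=> x Kx; apply: (MK (`|M| + 1)); last by exists x.
  by rewrite (le_lt_trans (ler_norm _)) // ltrDl.
have [M hM] := choice bnd.
exists (\sum_i M i); first by rewrite sumr_ge0 // => i _; exact: (hM i).1.
move=> x Kx i; rewrite (le_trans ((hM i).2 x Kx)) //.
by rewrite (bigD1 i) //= lerDl sumr_ge0 // => j _; exact: (hM j).1.
Qed.

Lemma support_fun_bounded K : convex_body K ->
  exists2 M, 0 <= M & forall u, unit_sphere d u ->
    `|support_fun K u| <= M /\ has_sup [set ip u x | x in K].
Proof.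
move=> [[x0 Kx0] [/compact_coord_bounded[M M0 MK] _]].
have ipM u x : unit_sphere d u -> K x -> `|ip u x| <= \sum_(i < d) M.
  move=> su Kx; rewrite /ip (le_trans (ler_norm_sum _ _ _)) // ler_sum // => i _.
  by rewrite normrM -[leRHS]mul1r ler_pM // ?MK // unit_sphere_le1.
exists (\sum_(i < d) M); first exact: sumr_ge0.
move=> u su.
have hs : has_sup [set ip u x | x in K].
  split; first by exists (ip u x0), x0.
  by exists (\sum_(i < d) M) => _ [x Kx <-]; rewrite (le_trans (ler_norm _)) // ipM.
split => //; rewrite ler_norml; apply/andP; split.
  apply: (@le_trans _ _ (ip u x0)).
    by have := ipM _ _ su Kx0; rewrite ler_norml => /andP[].
  by apply: ub_le_sup; [exact: hs.2|exists x0].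
apply: ge_sup; first exact: hs.1.
by move=> _ [x Kx <-]; rewrite (le_trans (ler_norm _)) // ipM.
Qed.

(** Compactness bounds the differences over the sphere, so that [sup] is a genuine upper bound. *)
Lemma support_fun_le_hausdorff K L u : convex_body K -> convex_body L ->
  unit_sphere d u -> `|support_fun K u - support_fun L u| <= hausdorff_dist K L.
Proof.
move=> /support_fun_bounded[M M0 MK] /support_fun_bounded[N N0 NL] su.
apply: ub_le_sup; last by exists u.
exists (M + N) => _ [v sv <-].
by rewrite (le_trans (ler_normB _ _)) // lerD //; [exact: (MK v sv).1|exact: (NL v sv).1].
Qed.

Lemma hausdorff_le K L e : 0 <= e ->
  (forall u, unit_sphere d u -> `|support_fun K u - support_fun L u| <= e) ->
  0 <= hausdorff_dist K L <= e.
Proof.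
move=> e0 h; rewrite /hausdorff_dist; set S := [set _ | _ in _].
(* The sphere is empty when [d = 0]; [sup] of the empty set is then 0. *)
have [->|/set0P S0] := eqVneq S set0; first by rewrite sup0 lexx e0.
apply/andP; split; last by apply: ge_sup => // _ [u su <-]; exact: h.
case: (S0) => y Sy; apply: (@le_trans _ _ y); first by case: Sy => u _ <-.
by apply: ub_le_sup => //; exists e => _ [u su <-]; exact: h.
Qed.

Lemma support_fun_sym K u : (forall x, K x -> K (- x)) ->
  support_fun K (- u) = support_fun K u.
Proof.
move=> sK; rewrite /support_fun; congr sup; apply/seteqP; split=> _ [x Kx <-].
  by exists (- x); [exact: sK|rewrite ipN ipNl].
by exists (- x); [exact: sK|rewrite ipN ipNl opprK].
Qed.

Lemma symmetric_centrally_symmetric K : (forall x, K x -> K (- x)) ->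
  centrally_symmetric K.
Proof.
move=> sK; exists 0; apply/seteqP; split=> _ [x Kx <-]; exists (- x) => //;
by [exact: sK|rewrite !subr0 ?opprK].
Qed.

(** The Wulff shape of [h]. *)
Definition body_of h : set 'rV[R]_d := [set x | forall u, ip u x <= h u].

Lemma body_of_sym h : (forall u, h (- u) = h u) ->
  forall x, body_of h x -> body_of h (- x).
Proof. by move=> hs x hx u; rewrite ipN -ipNl -hs hx. Qed.

Section ExposedPoints.
Variable h : 'rV[R]_d -> R.
Hypothesis hP : forall u, exists2 x, body_of h x & ip u x = h u.

Lemma body_of_convex_body : convex_body (body_of h).
Proof.
split; first by have [x hx _] := hP 0; exists x.
split; last first.
  move=> x y t hx hy t0 t1 u; rewrite ipDZ.
  have := hx u; have := hy u; nra.
(* The directions plus and minus [delta_mx 0 i] confine the body to a box, in which it is closed as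
   an intersection of closed half-spaces. *)
pose box i : set R := `[- h (- delta_mx 0 i), h (delta_mx 0 i)]%classic.
have cbox : compact [set v : 'rV[R]_d | forall i, box i (v ord0 i)].
  by apply: rV_compact => i; exact: segment_compact.
apply: (subclosed_compact _ cbox).
- rewrite (_ : body_of h = \bigcap_u (ip u @^-1` [set y | y <= h u])); last first.
    by apply/seteqP; split=> [x hx u _|x hx u]; [exact: hx|exact: (hx u I)].
  apply: closed_bigI => u _; apply: closed_comp; last exact: closed_le.
  by move=> x _; exact: ip_continuous.
- move=> x hx i; rewrite /box /= in_itv /= -!ip_delta; apply/andP; split; last exact: hx.
  by rewrite lerNl -ipNl.
Qed.

(** The point supplied by [hP] attains [h u], which is an upper bound by the definition of
    [body_of]. *)
Lemma support_fun_body_of u : support_fun (body_of h) u = h u.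
Proof.
have [x hx xu] := hP u.
have ub : ubound [set ip u x | x in body_of h] (h u).
  by move=> _ [y hy <-]; exact: hy.
apply/eqP; rewrite eq_le; apply/andP; split.
  by apply: ge_sup => //; exists (ip u x), x.
by rewrite -[leLHS]xu; apply: ub_le_sup; [exists (h u)|exists x].
Qed.

End ExposedPoints.

Lemma trace_norm_lincombN m (A : 'I_d -> 'M[R[i]]_m) u :
  (forall i, Defs.hermitian (A i)) ->
  trace_norm (lincomb (- u) A) = trace_norm (lincomb u A).
Proof.
move=> hA; rewrite -[RHS]mul1r -(normrN1 R) -trace_normZ; last exact: lincomb_hermitian.
congr trace_norm; rewrite /lincomb scaler_sumr; apply: eq_bigr => i _.
by rewrite mxE scalerA -rmorphM mulN1r.
Qed.

Lemma operatope_of_trace_norms (m N : nat) (A : 'I_N -> 'I_d -> 'M[R[i]]_m) :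
  (0 < N)%N -> (forall j i, Defs.hermitian (A j i)) ->
  exists2 K, operatope m K &
    forall u, support_fun K u = \sum_(j < N) trace_norm (lincomb u (A j)).
Proof.
move=> N0 hA; pose h u := \sum_(j < N) trace_norm (lincomb u (A j)).
have hP u : exists2 x, body_of h x & ip u x = h u.
  have /choice[X hX] j := trace_norm_subgradient (lincomb_hermitian u (hA j)).
  (* The subgradients [X j] pulled back along [v |-> lincomb v (A j)] and summed, so that [ip v x]
     is the sum of the trace pairings. *)
  pose x : 'rV[R]_d := \row_i \sum_j complex.Re (\tr (A j i *m X j)).
  have ipx v : ip v x = \sum_j complex.Re (\tr (lincomb v (A j) *m X j)).
    rewrite /ip; under eq_bigr do rewrite mxE mulr_sumr.
    rewrite exchange_big /=; apply: eq_bigr => j _.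
    rewrite /lincomb mulmx_suml (raddf_sum (@mxtrace _ m)) Re_sum; apply: eq_bigr => i _.
    by rewrite -scalemxAl /= mxtraceZ Re_mulrC.
  exists x.
    move=> v; rewrite ipx; apply: ler_sum => j _.
    exact/(hX j).2/lincomb_hermitian.
  by rewrite ipx; apply: eq_bigr => j _; exact: (hX j).1.
have hN u : h (- u) = h u by apply: eq_bigr => j _; exact: trace_norm_lincombN.
exists (body_of h); last by move=> u; rewrite support_fun_body_of.
split; first exact/symmetric_centrally_symmetric/body_of_sym.
split; first exact: body_of_convex_body.
exists N, 0, A; split => //; split => // u; rewrite support_fun_body_of //.
by rewrite /ip big1 ?add0r // => i _; rewrite mxE mul0r.
Qed.

End SupportFunctions.

(** * Finitely supported approximations of random vectors *)

Section FiniteValued.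
Import HBSimple.
Set Implicit Arguments. Unset Strict Implicit. Unset Printing Implicit Defensive.
Variables (R : realType) (dsp : measure_display) (Omega : measurableType dsp).
Variable P : probability Omega R.

Lemma finite_valuedE (I : finType) (phi : Omega -> I) (F : I -> R) :
  F \o phi = (fun w => \sum_(i : I) F i * \1_(phi @^-1` [set i]) w).
Proof.
apply/funext => w /=; rewrite (bigD1 (phi w)) //= big1 ?addr0.
  by rewrite indicE mem_set // mulr1.
by move=> i /eqP iw; rewrite indicE memNset ?mulr0 // => /esym.
Qed.

Lemma measurable_finite_valued (I : finType) (phi : Omega -> I) (F : I -> R) :
  (forall i, measurable (phi @^-1` [set i])) -> measurable_fun setT (F \o phi).
Proof.
move=> mphi; rewrite finite_valuedE; apply: measurable_sum => i.
by apply: measurable_funM => //; exact: measurable_indic.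
Qed.

Lemma integral_finite_valued (I : finType) (phi : Omega -> I) (F : I -> R) :
  (forall i, measurable (phi @^-1` [set i])) -> (forall i, 0 <= F i) ->
  (\int[P]_w (F (phi w))%:E)%E =
  (\sum_(i : I) F i * fine (P (phi @^-1` [set i])))%:E.
Proof.
move=> mphi F0.
transitivity (\int[P]_w (\sum_(i : I) (F i)%:E * (\1_(phi @^-1` [set i]) w)%:E))%E.
  apply: eq_integral => w _; rewrite -[F (phi w)]/((F \o phi) w) finite_valuedE.
  by rewrite -sumEFin; apply: eq_bigr => i _; rewrite EFinM.
rewrite ge0_integral_sum //; last 2 first.
- move=> i; apply: emeasurable_funM => //.
  by apply/measurable_EFinP; exact: measurable_indic.
- by move=> i w _; rewrite -EFinM lee_fin mulr_ge0.
rewrite -sumEFin; apply: eq_bigr => i _.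
rewrite ge0_integralZl_EFin //; last first.
  by apply/measurable_EFinP; exact: measurable_indic.
rewrite integral_indic // setIT EFinM fineK //.
exact: fin_num_measure.
Qed.

(** The inequalities [f <= g + e] and [g <= f + e] are integrated in the extended reals; together
    they force the integral of [f] to be finite and within [D] of [r]. *)
Lemma integral_approx (f g e : Omega -> R) (r D : R) :
  measurable_fun setT f -> measurable_fun setT g -> measurable_fun setT e ->
  (forall w, 0 <= f w) -> (forall w, 0 <= g w) -> (forall w, `|f w - g w| <= e w) ->
  (\int[P]_w (g w)%:E)%E = r%:E -> (\int[P]_w (e w)%:E <= D%:E)%E ->
  exists2 s, (\int[P]_w (f w)%:E)%E = s%:E & `|s - r| <= D.
Proof.
move=> mf mg me f0 g0 fge gr eD.
have e0 w : 0 <= e w by exact: le_trans (fge w).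
have le1 : (\int[P]_w (f w)%:E <= (r + D)%:E)%E.
  rewrite EFinD -gr; apply: le_trans (leeD (lexx _) eD).
  rewrite -ge0_integralD //; try by [move=> w _; rewrite lee_fin | apply/measurable_EFinP].
  apply: ge0_le_integral => //.
  - by move=> w _; rewrite lee_fin.
  - exact/measurable_EFinP.
  - by apply/measurable_EFinP; exact: measurable_funD.
  - by move=> w _; rewrite -EFinD lee_fin -lerBlDl (le_trans (ler_norm _)).
have le2 : (r%:E <= \int[P]_w (f w)%:E + D%:E)%E.
  rewrite -gr; apply: le_trans (leeD (lexx _) eD).
  rewrite -ge0_integralD //; try by [move=> w _; rewrite lee_fin | apply/measurable_EFinP].
  apply: ge0_le_integral => //.
  - by move=> w _; rewrite lee_fin.
  - exact/measurable_EFinP.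
  - by apply/measurable_EFinP; exact: measurable_funD.
  - by move=> w _; rewrite -EFinD lee_fin -lerBlDl (le_trans (ler_norm _)) // distrC.
have ge0 : (0 <= \int[P]_w (f w)%:E)%E by apply: integral_ge0 => w _; rewrite lee_fin.
move: le1 le2 ge0; case: (\int[P]_w _)%E => // s.
rewrite -EFinD !lee_fin => le1 le2 _; exists s => //.
by rewrite ler_norml; apply/andP; split; lra.
Qed.

Definition l1_lipschitz (J : finType) (L : R) (F : (J -> R) -> R) :=
  forall a b, `|F a - F b| <= L * \sum_j `|a j - b j|.

(** A Lipschitz [F] is continuous, so [F (X w)] is a pointwise limit of measurable functions; no
    sigma-algebra on [J -> R] is involved. *)
Lemma lipschitz_measurable (J : finType) (L : R) (F : (J -> R) -> R)
    (X : Omega -> J -> R) (G : nat -> Omega -> J -> R) :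
  l1_lipschitz L F ->
  (forall n, measurable_fun setT (fun w => F (G n w))) ->
  (forall w j, (fun n => G n w j) @ \oo --> X w j) ->
  measurable_fun setT (fun w => F (X w)).
Proof.
move=> lF mG GX; apply: (measurable_fun_cvg mG) => w _.
apply/cvgrPdist_le => e e0.
(* The added 1 keeps the denominator positive when [L] or [#|J|] vanishes. *)
have K0 : 0 < `|L| * #|J|%:R + 1 by rewrite ltr_wpDl ?mulr_ge0.
have d0 : 0 < e / (`|L| * #|J|%:R + 1) by rewrite divr_gt0.
have : \forall n \near \oo, forall j, `|X w j - G n w j| <= e / (`|L| * #|J|%:R + 1).
  apply: filter_forall => j; move: (GX w j) => /cvgrPdist_le; exact.
apply: filterS => n h; rewrite (le_trans (lF _ _)) //.
apply: (@le_trans _ _ (`|L| * \sum_(j : J) (e / (`|L| * #|J|%:R + 1)))).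
  by rewrite (le_trans (ler_wpM2r _ (ler_norm L))) ?sumr_ge0 // ler_wpM2l // ler_sum.
rewrite sumr_const -[_ *+ _]mulr_natl !mulrA ler_pdivrMr // mulrDr mulr1.
by rewrite [`|L| * _ * e]mulrC lerDl ltW.
Qed.

(** A finite family of simple functions factors through one finite type: [phi] records, for each
    [j], the position of [g j w] in a list of the values of [g j]. *)
Lemma simple_family_law (J : finType) (g : J -> {sfun Omega >-> R}) :
  exists (I : finType) (phi : Omega -> I) (v : I -> J -> R),
    (0 < #|I|)%N /\ (forall i, measurable (phi @^-1` [set i])) /\
    forall w, v (phi w) = (fun j => g j w).
Proof.
have /choice[r hr] : forall j, exists r : seq R, forall w, g j w \in r.
  move=> j; have /finite_seqP[r fr] := fimfunP (g j).
  by exists r => w; have : [set` r] (g j w) by rewrite -fr; exists w.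
pose M := \max_j size (r j).
have hM j w : (index (g j w) (r j) < M.+1)%N.
  rewrite ltnS (leq_trans (index_size _ _)) //.
  exact: (leq_bigmax (F := fun j => size (r j))).
exists {ffun J -> 'I_M.+1}, (fun w => [ffun j => inord (index (g j w) (r j))]).
exists (fun (f : {ffun J -> 'I_M.+1}) j => nth 0 (r j) (f j)); split; [|split].
- by rewrite card_ffun expn_gt0 card_ord.
- move=> f; rewrite (_ : _ @^-1` _ = \bigcap_(j in [set: J])
     (g j @^-1` [set x | (index x (r j) == f j)%N && (x \in r j)])); last first.
    apply/seteqP; split=> w /=.
      by move=> <- j _ /=; rewrite ffunE inordK ?hM // eqxx hr.
    move=> h; apply/ffunP => j; rewrite ffunE; apply/val_inj.
    by rewrite /= inordK ?hM //; have /andP[/eqP-> _] := h j I.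
  apply: fin_bigcap_measurable => // j _.
  rewrite -[X in measurable X]setTI; apply: measurable_funPT => //.
  apply: countable_measurable; first by move=> t; exact: measurable_set1.
  apply: finite_set_countable.
  apply: (sub_finite_set (B := [set` r j])); last exact: finite_seq.
  by move=> x /= /andP[].
- by move=> w; apply/funext => j; rewrite ffunE inordK ?hM // nth_index ?hr.
Qed.

Lemma integral_l1 (J : finType) (L : R) (u : J -> Omega -> R) :
  0 <= L -> (forall j, measurable_fun setT (u j)) ->
  (\int[P]_w (L * \sum_j `|u j w|)%:E = L%:E * \sum_j \int[P]_w `|(u j w)%:E|)%E.
Proof.
move=> L0 mu.
have mn j : measurable_fun setT (fun w => `|(u j w)%:E|)%E.
  by apply: measurableT_comp => //; exact/measurable_EFinP.
under eq_integral do rewrite EFinM -sumEFin.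
rewrite ge0_integralZl_EFin //.
- by rewrite ge0_integral_sum.
- by move=> w _; apply: sume_ge0.
- exact: emeasurable_sum.
Qed.

(** The finite law is fixed before the test function [F], so one approximation serves all directions
    [u] at once and gives uniform convergence on the sphere. *)
Lemma finite_support_approx (J : finType) (X : Omega -> J -> R) (e : R) :
  (forall j, P.-integrable setT (fun w => (X w j)%:E)) -> 0 < e ->
  exists (I : finType) (p : I -> R) (v : I -> J -> R),
    [/\ (0 < #|I|)%N, forall i, 0 <= p i & forall (F : (J -> R) -> R) (L r : R), 0 <= L ->
      (forall a, 0 <= F a) -> l1_lipschitz L F ->
      (\int[P]_w (F (X w))%:E)%E = r%:E ->
      `|\sum_i p i * F (v i) - r| <= L * e].
Proof.
move=> iX e0.
have [g hg] := choice (fun j => approximation_sfun_integrable measurableT (iX j)).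
have mX j : measurable_fun setT (fun w => X w j).
  by apply/measurable_EFinP; exact: measurable_int (iX j).
have law n := simple_family_law (fun j => g j n).
have mFG n (F : (J -> R) -> R) : measurable_fun setT (fun w => F (fun j => g j n w)).
  have [I [phi [v [_ [mphi hv]]]]] := law n.
  rewrite (_ : (fun w => _) = (F \o v) \o phi); last first.
    by apply/funext => w /=; rewrite hv.
  exact: measurable_finite_valued.
(* Each coordinate gets the error budget [e / (#|J| + 1)], so the sum over [J] stays below [e]. *)
have K0 : 0 < #|J|%:R + 1 :> R by rewrite ltr_wpDl.
have d0 : 0 < e / (#|J|%:R + 1) by rewrite divr_gt0.
have [n hn] : exists n, forall j,
    (\int[P]_w `|(X w j)%:E - (g j n w)%:E| <= (e / (#|J|%:R + 1))%:E)%E.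
  have : \forall n \near \oo, forall j,
    (\int[P]_w `|(X w j)%:E - (g j n w)%:E| <= (e / (#|J|%:R + 1))%:E)%E.
    apply: filter_forall => j; have [_ _ cv] := hg j.
    move/fine_cvgP: cv => [fin /cvgrPdist_le/(_ _ d0)].
    apply: filterS2 fin => n fin; rewrite sub0r normrN => h.
    by rewrite -(fineK fin) lee_fin (le_trans (ler_norm _)).
  by case=> N _ hN; exists N; apply: hN => /=.
have [I [phi [v [I0 [mphi hv]]]]] := law n.
exists I, (fun i => fine (P (phi @^-1` [set i]))), v.
split=> [//|i|F L r L0 F0 lF Fr]; first exact/fine_ge0/measure_ge0.
have mFX : measurable_fun setT (fun w => F (X w)).
  apply: (@lipschitz_measurable _ L F X (fun n w j => g j n w) lF) => // w j.
  have [_ /(_ w Logic.I) + _] := hg j.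
  by move/fine_cvgP => [_].
have mu j : measurable_fun setT (fun w => X w j - g j n w).
  by apply: measurable_funB => //.
have [s sE sr] : exists2 s, (\int[P]_w (F (v (phi w)))%:E)%E = s%:E & `|s - r| <= L * e.
  under eq_integral do rewrite hv.
  apply: (@integral_approx _ (fun w => F (X w))
    (fun w => L * \sum_j `|X w j - g j n w|)) => //.
  - apply: measurable_funM => //; apply: measurable_sum => j.
    by apply: measurableT_comp => //.
  - by move=> w; rewrite distrC; exact: lF.
  - rewrite integral_l1 // EFinM lee_wpmul2l ?lee_fin //.
    apply: (@le_trans _ _ (\sum_(j : J) (e / (#|J|%:R + 1))%:E)%E).
      by apply: lee_sum => j _; under eq_integral do rewrite EFinB; exact: hn.
    rewrite sumEFin lee_fin sumr_const -[_ *+ _]mulr_natl mulrA ler_pdivrMr //.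
    by rewrite mulrDr mulr1 [_ * e]mulrC lerDl ltW.
move: sE; rewrite (integral_finite_valued (F := fun i => F (v i))) // => -[sE].
by under eq_bigr do rewrite mulrC; rewrite sE.
Qed.

End FiniteValued.

(** * Weak limits of finitely supported laws *)

Section CellCodes.
Set Implicit Arguments. Unset Strict Implicit. Unset Printing Implicit Defensive.
Variables (R : realType) (J : finType) (C : R).
Implicit Types (a b : J -> R) (k c : nat).

Definition in_box a := forall j, `|a j| <= C.

Definition grid_index k (x : R) : nat := Num.trunc ((x + C) * 2 ^+ k).

(** Cells have side [2^-k]. For points of the box the largest index is reached at coordinate [C], so
    [inord] leaves their indices unchanged. *)
Definition grid_cell k a : {ffun J -> 'I_(Num.trunc (2 * C * 2 ^+ k)).+1} :=
  [ffun j => inord (grid_index k (a j))].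

Definition ncells k := #|{ffun J -> 'I_(Num.trunc (2 * C * 2 ^+ k)).+1}|.

Fixpoint ncodes k : nat := if k is k'.+1 then ncodes k' * ncells k' else 1.

(* Each code lists the cells of all coarser grids, most significant first, so
   that the codes of level [k] refine those of level [k - 1] monotonically. *)
Fixpoint code k a : nat :=
  if k is k'.+1 then code k' a * ncells k' + enum_rank (grid_cell k' a) else 0.

Lemma ncells_gt0 k : (0 < ncells k)%N.
Proof. by rewrite /ncells card_ffun expn_gt0 card_ord. Qed.

Lemma code_lt k a : (code k a < ncodes k)%N.
Proof.
elim: k => //= k IH; have := ltn_ord (enum_rank (grid_cell k a)).
rewrite -/(ncells k) => lt.
by rewrite (@leq_trans ((code k a).+1 * ncells k)) // ?leq_mul2r ?IH ?orbT // mulSn addnC ltn_add2r.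
Qed.

Definition code_ord k a := Ordinal (code_lt k a).

Lemma code_div k a : (code k.+1 a %/ ncells k)%N = code k a.
Proof.
by rewrite /= divnMDl ?ncells_gt0 // divn_small ?addn0 // ltn_ord.
Qed.

Lemma eq_code_le k l a b : (k <= l)%N -> code l a = code l b -> code k a = code k b.
Proof.
move=> /subnK <-; elim: (l - k)%N => // n IH; rewrite addSn => e.
by apply: IH; rewrite -(code_div _ a) -(code_div _ b) e.
Qed.

(** The last digit of a code of level [k.+1] is the cell in grid [k], since level 0 carries no
    digit; hence the shift by one between level and mesh. *)
Lemma code_close k a b : in_box a -> in_box b -> code k.+1 a = code k.+1 b ->
  forall j, `|a j - b j| <= (2 ^+ k)^-1.
Proof.
move=> ha hb eab j.
have p0 : 0 < 2 ^+ k :> R by rewrite exprn_gt0.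
have ecell : grid_cell k a = grid_cell k b.
  apply/enum_rank_inj/val_inj/eqP.
  by rewrite -(eqn_add2l (code k a * ncells k)) {2}(eq_code_le (leqnSn k) eab) -/(code k.+1 a) eab.
have box x : `|x| <= C -> 0 <= (x + C) * 2 ^+ k /\
    (grid_index k x < (Num.trunc (2 * C * 2 ^+ k)).+1)%N.
  rewrite ler_norml => /andP[x1 x2]; split; first by rewrite mulr_ge0 ?(ltW p0) //; lra.
  by rewrite ltnS le_truncn // ler_wpM2r ?(ltW p0) //; lra.
have [a0 a1] := box _ (ha j); have [b0 b1] := box _ (hb j).
have eidx : grid_index k (a j) = grid_index k (b j).
  by have := congr1 (fun f : {ffun J -> _} => nat_of_ord (f j)) ecell; rewrite !ffunE !inordK.
have /andP[] := truncn_itv a0; have /andP[] := truncn_itv b0.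
rewrite -!/(grid_index k _) eidx -natr1; set g := _%:R => h1 h2 h3 h4.
have h : `|(a j - b j) * 2 ^+ k| <= 1.
  rewrite (_ : (a j - b j) * 2 ^+ k = (a j + C) * 2 ^+ k - (b j + C) * 2 ^+ k); last by ring.
  by rewrite ler_norml; apply/andP; split; lra.
by rewrite -(ler_pM2r p0) mulVf ?gt_eqF // -{1}(ger0_norm (ltW p0)) -normrM.
Qed.

End CellCodes.

(** By compactness the image ultrafilter clusters at a point, and an ultrafilter converges to its
    cluster points. All cumulated masses thus converge along one ultrafilter, with no diagonal
    extraction. *)
Lemma ultrafilter_bounded_cvg (R : realType) (T : Type) (U : set_system T)
    (f : T -> R) (a b : R) :
  UltraFilter U -> (forall t, a <= f t <= b) -> exists l : R, f @ U --> l.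
Proof.
move=> UU fab.
have [l [_ cl]] : `[a, b]%classic `&` cluster (f @ U) !=set0.
  apply: segment_compact; change (U (f @^-1` `[a, b]%classic)); apply: filterE => t /=.
  by rewrite in_itv /=; exact: fab.
exists l => V nV; have [//|UV] := in_ultra_setVsetC (f @^-1` V) UU.
by have [y []] := cl (~` V) V UV nV.
Qed.

(** * The uniform law on the unit interval *)

Section UniformMeasure.
Variable R : realType.

Definition unit_unif : probability _ R := uniform_prob (@ltr01 R).

Lemma unit_unif_itv (x y : R) : 0 <= x -> x <= y -> y <= 1 ->
  unit_unif `[x, y[%classic = (y - x)%:E.
Proof.
move=> x0 xy y1; rewrite /unit_unif /= /uniform_prob.
rewrite (eq_integral (fun=> 1%:E)); last first.
  move=> t; rewrite inE /= in_itv /= => /andP[xt ty].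
  by rewrite /uniform_pdf (le_trans x0 xt) (le_trans (ltW ty) y1) subr0 invr1.
rewrite integral_cst //= mul1e lebesgue_measure_itv /= lte_fin.
have [//|yx] := ltP x y.
by rewrite (_ : y = x) ?subrr //; apply/eqP; rewrite eq_le yx xy.
Qed.

End UniformMeasure.

Lemma cvg_bigsum (R : realType) (T : Type) (U : set_system T) (I : Type)
    (s : seq I) (f : I -> T -> R) (l : I -> R) :
  Filter U -> (forall i, f i @ U --> l i) ->
  (fun t => \sum_(i <- s) f i t) @ U --> \sum_(i <- s) l i.
Proof.
move=> FU fl; elim: s => [|i s IH].
  by under eq_fun do rewrite big_nil; rewrite big_nil; exact: cvg_cst.
under eq_fun do rewrite big_cons; rewrite big_cons.
exact: (cvgD (fl i) IH).
Qed.

Lemma sum_option (V : nmodType) (T : finType) (G : option T -> V) :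
  \sum_o G o = G None + \sum_c G (Some c).
Proof.
rewrite (bigD1 None) //=; congr (_ + _).
rewrite (reindex_omap Some id) /=; last by case.
by apply: eq_bigl => c; rewrite eqxx.
Qed.

(** * Construction of the limit law on the unit interval *)

Section WeakLimit.
Set Implicit Arguments. Unset Strict Implicit. Unset Printing Implicit Defensive.
Variables (R : realType) (J : finType) (C : R).
Variables (I : nat -> finType) (p : forall n, I n -> R) (v : forall n, I n -> J -> R).
Hypotheses (C0 : 0 <= C) (p_ge0 : forall n i, 0 <= p (n := n) i).
Hypotheses (sum_p : forall n, \sum_i p (n := n) i = 1).
Hypotheses (v_box : forall n i, in_box C (v (n := n) i)).

Local Notation B := (@ncodes R J C).
Local Notation D := (@ncells R J C).
Local Notation code := (@code R J C).

(** The distribution function of the level-[k] code under the [n]-th law. *)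
Let below n k c : R := \sum_(i | (code k (v (n := n) i) < c)%N) p i.

Variable U : set_system nat.
Hypothesis UU : UltraFilter U.

Variable beta : nat -> nat -> R.
Hypothesis betaP : forall k c, (fun n => below n k c) @ U --> beta k c.

Let beta_le k c l c' : (forall n, below n k c <= below n l c') -> beta k c <= beta l c'.
Proof. by move=> h; apply: (ler_cvg_to (@betaP k c) (@betaP l c')); exact: nearW. Qed.

Let beta_eq k c l c' : (forall n, below n k c = below n l c') -> beta k c = beta l c'.
Proof.
by move=> h; apply/eqP; rewrite eq_le !beta_le // => n; rewrite h.
Qed.

Let beta_cst k c x : (forall n, below n k c = x) -> beta k c = x.
Proof.
move=> h; have := @betaP k c; under eq_fun do rewrite h.
by move=> /(cvg_unique (@norm_hausdorff _ _)); apply; exact: cvg_cst.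
Qed.

Let beta0 k : beta k 0 = 0.
Proof. by apply: beta_cst => n; rewrite /below big_pred0. Qed.

Let betaB k : beta k (B k) = 1.
Proof.
apply: beta_cst => n; rewrite -(sum_p n); apply: eq_bigl => i.
by rewrite code_lt.
Qed.

Let below_mono n k c c' : (c <= c')%N -> below n k c <= below n k c'.
Proof.
move=> cc'; rewrite /below [leRHS](bigID (fun i => (code k (v i) < c)%N)) /=.
rewrite [X in _ <= X + _](eq_bigl (fun i => (code k (v i) < c)%N)); last first.
  by move=> i; rewrite andb_idl // => /leq_trans; apply.
by rewrite lerDl sumr_ge0.
Qed.

Let beta_mono k c c' : (c <= c')%N -> beta k c <= beta k c'.
Proof. by move=> cc'; apply: beta_le => n; exact: below_mono. Qed.

(** A code of level [k.+1] is below [c * D k] exactly when its level-[k] prefix is below [c].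
    Breakpoints of one level thus recur at the next, so the intervals are nested. *)
Let beta_refine k c : beta k.+1 (c * D k) = beta k c.
Proof.
apply: beta_eq => n; apply: eq_bigl => i.
by rewrite -(code_div C k) ltn_divLR // ncells_gt0.
Qed.

(** The interval assigned to [c] has the limiting mass of that cell as its length; being half-open,
    these intervals partition [[0, 1)]. *)
Let in_cell k (w : R) (c : nat) := beta k c <= w < beta k c.+1.

Let cell_of k (w : R) : option 'I_(B k) := [pick c : 'I_(B k) | in_cell k w c].

Let in_cell_inj k w c c' : in_cell k w c -> in_cell k w c' -> c = c'.
Proof.
move=> /andP[h1 h2] /andP[h3 h4].
case: (ltngtP c c') => // /(beta_mono k) h.
  by have := lt_le_trans h2 (le_trans h h3); rewrite ltxx.
by have := lt_le_trans h4 (le_trans h h1); rewrite ltxx.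
Qed.

Let cell_ofP k w c : cell_of k w = Some c <-> in_cell k w c.
Proof.
rewrite /cell_of; case: pickP => [c' hc'|h]; split => //.
- by case=> <-.
- by move=> hc; congr Some; apply/val_inj/(in_cell_inj hc').
- by rewrite h.
Qed.

Let cell_of_total k w : 0 <= w < 1 -> exists c, cell_of k w = Some c.
Proof.
move=> /andP[w0 w1].
(* The least [c] with [w < beta k c] is positive because [beta k 0 = 0]; its predecessor is the
   cell. *)
have ex : exists c, w < beta k c by exists (B k); rewrite betaB.
case: (ex_minnP ex) => -[|c]; first by rewrite beta0 ltNge w0.
move=> wc min; have cB : (c < B k)%N by apply: min; rewrite betaB.
exists (Ordinal cB); apply/cell_ofP; rewrite /in_cell /= wc andbT leNgt.
by apply/negP => /min; rewrite ltnn.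
Qed.

Let cell_of_range k w c : cell_of k w = Some c -> 0 <= w < 1.
Proof.
move=> /cell_ofP/andP[h1 h2]; rewrite -(beta0 k) -(betaB k).
by rewrite (le_trans (beta_mono k (leq0n c)) h1) (lt_le_trans h2) ?beta_mono.
Qed.

Let cell_of_refine k w c c' : cell_of k w = Some c -> cell_of k.+1 w = Some c' ->
  (c' %/ D k)%N = c.
Proof.
move=> /cell_ofP hc /cell_ofP/andP[h1 h2]; apply/esym; apply: (in_cell_inj hc).
rewrite /in_cell -(beta_refine k (c' %/ D k)) -(beta_refine k (c' %/ D k).+1).
rewrite (le_trans _ h1) ?(lt_le_trans h2) //.
  by rewrite beta_mono // -ltn_divLR ?ncells_gt0.
by rewrite beta_mono // leq_divM.
Qed.

(** A point of the box with the given code; the default 0 also lies in the box and covers unrealized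
    codes and points outside [[0, 1)]. *)
Let rep k (o : option 'I_(B k)) : J -> R :=
  if o is Some c then xget (fun=> 0) [set a | in_box C a /\ code k a = c] else fun=> 0.

Let rep_box k o : in_box C (@rep k o).
Proof.
by case: o => [c|] j /=; [case: xgetP => [_ -> []|_] //|]; rewrite normr0.
Qed.

Let code_rep k a (c : 'I_(B k)) : in_box C a -> code k a = c :> nat ->
  code k (@rep k (Some c)) = c.
Proof.
move=> ba ca; rewrite /rep /=.
by have [] := @xgetI _ (fun=> 0) [set a | in_box C a /\ code k a = c] a (conj ba ca).
Qed.

(** A code realized by no point of the box carries no mass under any of the laws, so its interval is
    empty and cannot contain [w]. *)
Let code_rep_cell k w c : cell_of k w = Some c -> code k (@rep k (Some c)) = c.
Proof.
move=> /cell_ofP/andP[h1 h2].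
have [[a [ba ca]]|no] := pselect (exists a, in_box C a /\ code k a = c).
  exact: code_rep ba ca.
have : beta k c = beta k c.+1; last first.
  by move=> e; have := le_lt_trans h1 h2; rewrite e ltxx.
apply: beta_eq => n; apply: eq_bigl => i; rewrite [in RHS]ltnS [in RHS]leq_eqVlt.
suff -> : (code k (v i) == c) = false by [].
by apply/eqP => e; apply: no; exists (v i); split; [exact: v_box|].
Qed.

Let A k (w : R) : J -> R := @rep k (cell_of k w).

Let code_A k w : 0 <= w < 1 -> cell_of k w = Some (code_ord C k (A k w)).
Proof.
move=> /(cell_of_total k)[c hc]; rewrite /A hc; congr Some; apply/val_inj.
exact: (esym (code_rep_cell hc)).
Qed.

Let A_out k w : ~~ (0 <= w < 1) -> A k w = fun=> 0.
Proof.
by move=> wn; rewrite /A; case e: cell_of => [c|] //; rewrite (cell_of_range e) in wn.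
Qed.

(** The cells chosen for [w] are nested, so both values share their code of level [k.+1] and
    [code_close] applies. *)
Let A_close k l w : (k < l)%N -> forall j, `|A k.+1 w j - A l w j| <= (2 ^+ k)^-1.
Proof.
move=> kl j; have [w01|wn] := boolP (0 <= w < 1); last first.
  by rewrite !A_out // subrr normr0 invr_ge0 exprn_ge0.
apply: (@code_close _ _ C); try exact: rep_box.
move: kl => /subnK <-; elim: (l - k.+1)%N => // n ->.
rewrite addSn; apply: (eq_code_le (leq_addl n k.+1)).
rewrite -[RHS]code_div.
by have := cell_of_refine (code_A (n + k.+1) w01) (code_A (n + k.+1).+1 w01).
Qed.

Let X (w : R) (j : J) : R := lim ((fun k => A k w j) @ \oo).

Let half_small (e : R) : 0 < e -> exists k, (2 ^+ k)^-1 < e.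
Proof.
move=> e0; have [k hk] : exists k, e^-1 < 2 ^+ k.
  exists (Num.trunc e^-1).+1; apply: lt_trans (truncnS_gt _) _.
  by rewrite -natrX ltr_nat ltn_expl.
by exists k; rewrite -[ltRHS]invrK ltf_pV2 // posrE ?invr_gt0 ?exprn_gt0.
Qed.

Let A_cvg w j : (fun k => A k w j) @ \oo --> X w j.
Proof.
apply/cauchy_cvgP/cauchy_exP => e e0; have [k hk] := half_small e0.
exists (A k.+1 w j); exists k.+1 => // l /= kl.
by rewrite /ball /= (le_lt_trans (A_close w kl j)).
Qed.

Let A_X k w j : `|X w j - A k.+1 w j| <= (2 ^+ k)^-1.
Proof.
rewrite distrC; have h : (fun l => `|A k.+1 w j - A l w j|) @ \oo --> `|A k.+1 w j - X w j|.
  by apply: cvg_norm; apply: cvgB; [exact: cvg_cst|exact: A_cvg].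
have h2 : (fun l : nat => (2 ^+ k)^-1 : R) @ \oo --> ((2 ^+ k)^-1 : R) by exact: cvg_cst.
apply: (ler_cvg_to h h2).
by exists k.+1 => // l /= kl; exact: A_close.
Qed.

Let cell_set k (c : 'I_(B k)) : cell_of k @^-1` [set Some c] = `[beta k c, beta k c.+1[%classic.
Proof.
apply/seteqP; split=> w /=; rewrite in_itv /=; first by move=> /cell_ofP.
by move=> h; apply/cell_ofP.
Qed.

Let none_set k : cell_of k @^-1` [set None] = ~` `[0, 1[%classic.
Proof.
apply/seteqP; split=> w /=; rewrite in_itv /=.
  by move=> h /(cell_of_total k)[c]; rewrite h.
by case e: cell_of => [c|] // []; exact: cell_of_range e.
Qed.

Let measurable_cell k o : measurable (cell_of k @^-1` [set o]).
Proof.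
case: o => [c|]; first by rewrite cell_set; exact: measurable_itv.
by rewrite none_set; apply: measurableC; exact: measurable_itv.
Qed.

Let P := unit_unif R.

Let prob_cell k (c : 'I_(B k)) :
  fine (P (cell_of k @^-1` [set Some c])) = beta k c.+1 - beta k c.
Proof.
rewrite cell_set /P unit_unif_itv //.
- by rewrite -(beta0 k) beta_mono.
- by rewrite beta_mono.
- by rewrite -(betaB k) beta_mono.
Qed.

Let prob_none k : fine (P (cell_of k @^-1` [set None])) = 0.
Proof.
rewrite none_set /P probability_setC; last exact: measurable_itv.
by rewrite unit_unif_itv // subr0 subee.
Qed.

Let measurable_A k (F : (J -> R) -> R) : measurable_fun setT (fun w => F (A k w)).
Proof.
apply: (measurable_finite_valued (phi := cell_of k) (fun o => F (@rep k o))) => o.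
exact: measurable_cell.
Qed.

(** Replacing every atom by the representative of its cell changes the sum by at most the stated
    error, uniformly in [n]. The resulting sums involve only finitely many cell masses, which
    converge along [U]. *)
Let limit_law k (F : (J -> R) -> R) (L l : R) : 0 <= L -> (forall a, 0 <= F a) ->
  l1_lipschitz L F -> (fun n => \sum_i p (n := n) i * F (v i)) @ U --> l ->
  exists2 r, (\int[P]_w (F (A k.+1 w))%:E)%E = r%:E &
    `|r - l| <= L * (#|J|%:R * (2 ^+ k)^-1).
Proof.
(* The level is generalized to [K]; only the mesh bound [2^-k] for equal codes is retained. *)
move=> L0 F0 lF cl; move: k.+1 (@code_close _ J C k) => K close.
exists (\sum_(c < B K) F (@rep K (Some c)) * (beta K c.+1 - beta K c)).
  rewrite (integral_finite_valued P (F := fun o => F (@rep K o))) //; last exact: measurable_cell.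
  congr _%:E; rewrite sum_option prob_none mulr0 add0r.
  by apply: eq_bigr => c _; rewrite prob_cell.
have cr : (fun n => \sum_(c < B K) F (@rep K (Some c)) * (below n K c.+1 - below n K c))
    @ U --> \sum_(c < B K) F (@rep K (Some c)) * (beta K c.+1 - beta K c).
  apply: cvg_bigsum => c.
  by apply: cvgMl_tmp; apply: cvgB; exact: betaP.
rewrite distrC.
have bnd n : `|\sum_(c < B K) F (@rep K (Some c)) * (below n K c.+1 - below n K c) -
    \sum_i p (n := n) i * F (v i)| <= L * (#|J|%:R * (2 ^+ k)^-1).
  (* The atoms are grouped by code: those below [c.+1] but not below [c] have code exactly [c]. *)
  have -> : \sum_(c < B K) F (@rep K (Some c)) * (below n K c.+1 - below n K c) =
      \sum_i p (n := n) i * F (@rep K (Some (code_ord C K (v i)))).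
    rewrite [RHS](partition_big (fun i => code_ord C K (v i)) predT) //=.
    apply: eq_bigr => c _; rewrite /below (bigID (fun i => (code K (v i) < c)%N)) /=.
    rewrite (eq_bigl (fun i => (code K (v i) < c)%N)); last first.
      by move=> i; rewrite ltnS andb_idl // => /ltnW.
    rewrite addrAC subrr add0r mulr_sumr; apply: eq_big => [i|i].
      by rewrite ltnS -leqNgt -eqn_leq.
    rewrite ltnS -leqNgt -eqn_leq => /eqP e.
    by rewrite e mulrC.
  rewrite -sumrB (le_trans (ler_norm_sum _ _ _)) //.
  apply: (@le_trans _ _ (\sum_i p (n := n) i * (L * (#|J|%:R * (2 ^+ k)^-1)))).
    2: by rewrite -mulr_suml sum_p mul1r.
  apply: ler_sum => i _.
  rewrite -mulrBr normrM (ger0_norm (p_ge0 _)) ler_wpM2l //.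
  rewrite (le_trans (lF _ _)) // ler_wpM2l //.
  apply: (@le_trans _ _ (\sum_(j : J) (2 ^+ k)^-1)).
    apply: ler_sum => j _; apply: close => //.
    by rewrite (code_rep (v_box i)).
  by rewrite sumr_const mulr_natl.
have cn : (fun n => `|\sum_i p (n := n) i * F (v i) -
   \sum_(c < B K) F (@rep K (Some c)) * (below n K c.+1 - below n K c)|) @ U -->
   `|l - \sum_(c < B K) F (@rep K (Some c)) * (beta K c.+1 - beta K c)|.
  by apply: cvg_norm; exact: (cvgB cl cr).
have cc : (fun n : nat => L * (#|J|%:R * (2 ^+ k)^-1)) @ U --> L * (#|J|%:R * (2 ^+ k)^-1).
  exact: cvg_cst.
apply: (ler_cvg_to cn cc).
by apply: nearW => n; rewrite distrC.
Qed.

Lemma weak_limit_of_bounds : exists X : R -> J -> R,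
  [/\ forall j, measurable_fun setT (fun w => X w j),
     forall w j, `|X w j| <= C + 1 &
     forall (F : (J -> R) -> R) (L l : R), 0 <= L -> (forall a, 0 <= F a) ->
       l1_lipschitz L F -> (fun n => \sum_i p (n := n) i * F (v i)) @ U --> l ->
       (\int[unit_unif R]_w (F (X w))%:E)%E = l%:E].
Proof.
exists X; split.
- move=> j; apply: (@measurable_fun_cvg _ _ _ _ (fun k w => A k w j)) => // k.
  exact: (measurable_A k (fun a => a j)).
(* [A 1] lies in the box of radius [C], and [X] is within [2^0 = 1] of it. *)
- move=> w j; rewrite -(subrK (A 1 w j) (X w j)) (le_trans (ler_normD _ _)) //.
  rewrite addrC lerD //; first exact: rep_box.
  by rewrite (le_trans (A_X 0 _ _)) // expr0 invr1.
- move=> F L l L0 F0 lF cl.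
  have mFX : measurable_fun setT (fun w => F (X w)).
    by apply: (@lipschitz_measurable _ _ _ _ L F X (fun k w => A k w) lF).
  (* The factor 2 counts two equal errors: from [X] to [A k.+1], and from the law of [A k.+1] to the
     limit [l]. *)
  have key k : exists2 s, (\int[P]_w (F (X w))%:E)%E = s%:E &
      `|s - l| <= L * #|J|%:R * 2 * (2 ^+ k)^-1.
    have [r rE rl] := limit_law k L0 F0 lF cl.
    have fge w : `|F (X w) - F (A k.+1 w)| <= L * (#|J|%:R * (2 ^+ k)^-1).
      rewrite (le_trans (lF _ _)) // ler_wpM2l //.
      apply: (@le_trans _ _ (\sum_(j : J) (2 ^+ k)^-1)); first exact: ler_sum.
      by rewrite sumr_const mulr_natl.
    have [s sE sr] : exists2 s, (\int[P]_w (F (X w))%:E)%E = s%:E &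
        `|s - r| <= L * (#|J|%:R * (2 ^+ k)^-1).
      apply: (@integral_approx _ _ _ P (fun w => F (X w)) (fun w => F (A k.+1 w))
        (fun=> L * (#|J|%:R * (2 ^+ k)^-1))) => //; first exact: (measurable_A k.+1 F).
      rewrite integral_cst // [X in (_ * X)%E](_ : _ = 1%E) ?mule1 //.
      exact: (probability_setT P).
    exists s => //; rewrite -(subrK r s) -addrA (le_trans (ler_normD _ _)) //.
    rewrite (_ : _ * 2 * _ = L * (#|J|%:R * (2 ^+ k)^-1) + L * (#|J|%:R * (2 ^+ k)^-1)); last by ring.
    exact: lerD.
  (* Every [key k] concerns the same integral, so its value is arbitrarily close to [l]. *)
  have [s sE _] := key 0%N; rewrite sE; congr _%:E; apply/eqP; apply: contraT.
  rewrite -subr_eq0 -normr_gt0 => e0.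
  have c0 : 0 < L * #|J|%:R * 2 + 1 by rewrite ltr_wpDl ?mulr_ge0.
  have [k hk] := half_small (divr_gt0 e0 c0).
  have [s' s'E s'l] := key k; move: sE; rewrite s'E => -[ss]; rewrite {}ss in s'l.
  have : L * #|J|%:R * 2 * 2 ^- k < `|s - l|.
    apply: (@le_lt_trans _ _ ((L * #|J|%:R * 2 + 1) * 2 ^- k)).
      by rewrite ler_wpM2r ?invr_ge0 ?exprn_ge0 // lerDl.
    by rewrite mulrC -ltr_pdivlMr.
  by move=> /(le_lt_trans s'l); rewrite ltxx.
Qed.

End WeakLimit.

(** The ultrafilter is taken finer than the filter at infinity, so that ordinary limits of the test
    sums are also limits along it. *)
Lemma weak_limit (R : realType) (J : finType) (C : R) (I : nat -> finType)
    (p : forall n, I n -> R) (v : forall n, I n -> J -> R) :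
  0 <= C -> (forall n i, 0 <= p n i) -> (forall n, \sum_i p n i = 1) ->
  (forall n i, in_box C (v n i)) ->
  exists X : R -> J -> R,
  [/\ forall j, measurable_fun setT (fun w => X w j),
     forall w j, `|X w j| <= C + 1 &
     forall (F : (J -> R) -> R) (L l : R), 0 <= L -> (forall a, 0 <= F a) ->
       l1_lipschitz L F -> (fun n => \sum_i p n i * F (v n i)) @ \oo --> l ->
       (\int[unit_unif R]_w (F (X w))%:E)%E = l%:E].
Proof.
move=> C0 p0 sp vb; have [U [UU oU]] := @ultraFilterLemma _ (nbhs \oo) _.
have bnd n k c : 0 <= \sum_(i | (code C k (v n i) < c)%N) p n i <= 1.
  rewrite sumr_ge0 //= -(sp n) [leRHS](bigID (fun i => (code C k (v n i) < c)%N)) /=.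
  by rewrite lerDl sumr_ge0.
have /choice[beta hb] : forall k, exists b : nat -> R, forall c,
    (fun n => \sum_(i | (code C k (v n i) < c)%N) p n i) @ U --> b c.
  move=> k; have [b hb] := choice (fun c => ultrafilter_bounded_cvg UU
    (f := fun n => \sum_(i | (code C k (v n i) < c)%N) p n i) (fun n => bnd n k c)).
  by exists b.
have [X [mX bX hX]] := weak_limit_of_bounds C0 p0 sp vb UU hb.
exists X; split => // F L l L0 F0 lF cl; apply: (hX F L) => //.
by apply: cvg_trans cl => V; exact: oU.
Qed.

(** * Operanoids *)

Section Operanoids.
Set Implicit Arguments. Unset Strict Implicit. Unset Printing Implicit Defensive.
Variables (R : realType) (d m : nat).

Lemma measurable_frob_norm (dsp : measure_display) (Omega : measurableType dsp)
    (A : 'I_d -> Omega -> 'M[R[i]]_m) : random_hermitian_tuple A ->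
  measurable_fun setT (fun w => Num.sqrt (\sum_(i < d) frob2 (A i w))).
Proof.
move=> [hA mA].
apply: measurableT_comp; first by apply: continuous_measurable_fun; exact: sqrt_continuous.
apply: measurable_sum => i; under eq_fun do rewrite frob2E //.
apply: measurable_sum => j; apply: measurable_sum => k.
by apply: measurable_funD; apply: measurable_funX; case: (mA i j k).
Qed.

Lemma coord_le_frob_norm (A : 'I_d -> 'M[R[i]]_m) : (forall i, Defs.hermitian (A i)) ->
  forall x, `|coord_of A x| <= Num.sqrt (\sum_(i < d) frob2 (A i)).
Proof.
move=> hA [[[i j] k] r]; rewrite -sqrtr_sqr ler_sqrt; last first.
  by rewrite sumr_ge0 // => l _; exact: frob2_ge0.
rewrite (bigD1 i) //= (le_trans (_ : _ <= frob2 (A i))) ?lerDl ?sumr_ge0 //.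
  rewrite (le_trans _ (frob2_ge_entry (hA i) j k)) //.
  by case: r; rewrite ?lerDl ?lerDr sqr_ge0.
by move=> l _; exact: frob2_ge0.
Qed.

Lemma lip_cst_ge0 : 0 <= lip_cst R d m.
Proof. by rewrite /lip_cst sumr_ge0 // => i _; rewrite !mulr_ge0. Qed.

Lemma tnorm0 u : @tnorm R d m u (fun=> 0) = 0.
Proof. by have := @tnormZ R d m u 0 (fun=> 0); rewrite normr0 !mul0r. Qed.

(** Nonnegative weights are absorbed into the matrices by homogeneity of the trace norm. *)
Lemma operatope_of_finite_law (I : finType) (p : I -> R) (v : I -> coord d m -> R) :
  (0 < #|I|)%N -> (forall i, 0 <= p i) ->
  exists2 K : set 'rV[R]_d, operatope m K &
    forall u, support_fun K u = \sum_i p i * tnorm u (v i).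
Proof.
move=> I0 p0.
have [K oK hK] := @operatope_of_trace_norms R d m #|I|
  (fun j => herm_of (fun x => p (enum_val j) * v (enum_val j) x)) I0
  (fun j i => herm_of_hermitian _ i).
exists K => // u; rewrite hK.
rewrite [RHS](reindex (@enum_val I I)); last first.
  by apply: onW_bij; exact: enum_val_bij.
apply: eq_bigr => j _; rewrite -[trace_norm _]/(tnorm u _) tnormZ.
by rewrite ger0_norm.
Qed.

(** * From a random tuple to an operanoid *)

Section ExpectationToOperanoid.
Variables (Z : set 'rV[R]_d) (dsp : measure_display) (Omega : measurableType dsp).
Variables (P : probability Omega R) (A : 'I_d -> Omega -> 'M[R[i]]_m).
Hypotheses (cZ : convex_body Z) (sZ : forall x, Z x -> Z (- x)).
Hypothesis hA : random_hermitian_tuple A.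
Hypothesis iA : (\int[P]_w (Num.sqrt (\sum_(i < d) frob2 (A i w)))%:E < +oo)%E.
Hypothesis ZA : forall u : 'rV[R]_d, unit_sphere d u ->
  (support_fun Z u)%:E = (\int[P]_w (trace_norm (lincomb u (fun i => A i w)))%:E)%E.

Lemma integrable_coord x :
  P.-integrable setT (fun w => (coord_of (fun i => A i w) x)%:E).
Proof.
have mN := measurable_frob_norm hA; have [hA' mA] := hA.
apply: (@le_integrable _ _ _ P setT measurableT _
  (fun w => (Num.sqrt (\sum_(i < d) frob2 (A i w)))%:E)).
- apply/measurable_EFinP; case: x => [[[i j] k] r] /=.
  by case: r; case: (mA i j k).
- move=> w _ /=; rewrite lee_fin (le_trans (coord_le_frob_norm _ _)) //.
  exact: ler_norm.
- apply/integrableP; split; first exact/measurable_EFinP.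
  by under eq_integral do rewrite gee0_abs ?lee_fin ?sqrtr_ge0 //.
Qed.

Lemma operanoid_of_expectation : operanoid m Z.
Proof.
have [hA' mA] := hA.
have tA u w : tnorm u (coord_of (fun i => A i w)) = trace_norm (lincomb u (fun i => A i w)).
  by rewrite /tnorm coord_ofK.
have /choice[K hK] : forall n : nat, exists K, operatope m K /\ forall u, unit_sphere d u ->
    `|support_fun K u - support_fun Z u| <= lip_cst R d m * n.+1%:R^-1.
  move=> n.
  have e0 : 0 < n.+1%:R^-1 :> R by rewrite invr_gt0.
  have [I [p [v [I0 p0 hpv]]]] := finite_support_approx integrable_coord e0.
  have [K oK hK] := operatope_of_finite_law v I0 p0.
  exists K; split=> // u su; rewrite hK.
  apply: hpv; [exact: lip_cst_ge0|exact: tnorm_ge0|by move=> a b; exact: tnorm_lipschitz|].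
  rewrite (ZA su).
  apply: eq_integral => w _.
  exact: (congr1 EFin (tA u w)).
split; first exact: symmetric_centrally_symmetric.
split=> //; exists K; split; first by move=> n; exact: (hK n).1.
have h n : 0 <= hausdorff_dist (K n) Z <= lip_cst R d m * n.+1%:R^-1.
  apply: hausdorff_le; last exact: (hK n).2.
  by rewrite mulr_ge0 ?lip_cst_ge0.
apply: (@squeeze_cvgr _ _ _ _ (fun=> 0) (fun n => lip_cst R d m * n.+1%:R^-1)).
- by apply: nearW => n; exact: h.
- exact: cvg_cst.
- by rewrite -[X in _ --> X](mulr0 (lip_cst R d m)); apply: cvgMl_tmp; exact: cvg_harmonic.
Qed.

End ExpectationToOperanoid.

(** * From an operanoid to a random tuple *)

Section OperanoidToExpectation.
Variable Z : set 'rV[R]_d.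
Hypotheses (cZ : convex_body Z) (sZ : forall x, Z x -> Z (- x)) (oZ : operanoid m Z).

(** The translation [v] of the operatope disappears on averaging the estimates at [u] and [- u]: its
    contribution is odd, while the support function of [Z] and the trace norms are even. *)
Lemma operanoid_approx (e : R) : 0 < e ->
  exists (N : nat) (A : 'I_N -> 'I_d -> 'M[R[i]]_m),
    (forall j i, Defs.hermitian (A j i)) /\
    forall u, unit_sphere d u ->
      `|\sum_(j < N) trace_norm (lincomb u (A j)) - support_fun Z u| <= e.
Proof.
move=> e0; have [_ [_ [Zs [oZs /cvgrPdist_le/(_ e e0)[n _ /(_ n (leqnn n)) cv]]]]] := oZ.
have [_ [cK [N [v [A [N0 [hA hK]]]]]]] := oZs n.
exists N, A; split=> // u su.
have near u' : unit_sphere d u' -> `|support_fun (Zs n) u' - support_fun Z u'| <= e.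
  move=> su'; rewrite (le_trans (support_fun_le_hausdorff cK cZ su')) //.
  by move: cv; rewrite /= sub0r normrN; exact/le_trans/ler_norm.
set T := \sum_(j < N) _; set h := support_fun Z u.
have eN : support_fun (Zs n) (- u) = - ip v u + T.
  apply: (etrans (hK (- u)) (congr2 +%R (ipN v u) _)).
  by apply: eq_bigr => j _; exact: (trace_norm_lincombN u (hA j)).
have n1 : `|ip v u + T - h| <= e by rewrite /T -(hK u); exact: near.
have n2 : `|- ip v u + T - h| <= e.
  by rewrite -eN /h -(support_fun_sym u sZ); exact/near/unit_sphereN.
move: n1 n2; rewrite !ler_norml => /andP[? ?] /andP[? ?].
by apply/andP; split; lra.
Qed.

(** At a basis vector the linear combination is a single matrix, whose trace norm dominates each of
    its coordinates. The support function of [Z] therefore bounds the total mass uniformly in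
    [N]. *)
Lemma mass_bound : exists2 C : R, 0 < C & forall N (A : 'I_N -> 'I_d -> 'M[R[i]]_m),
  (forall j i, Defs.hermitian (A j i)) ->
  (forall u, unit_sphere d u ->
      `|\sum_(j < N) trace_norm (lincomb u (A j)) - support_fun Z u| <= 1) ->
  \sum_j \sum_x `|coord_of (A j) x| <= C.
Proof.
pose e (x : coord d m) : 'rV[R]_d := delta_mx 0 x.1.1.1.
(* The inner 1 is the tolerance of the approximation; the outer 1 makes the constant positive even
   when there are no coordinates. *)
exists (\sum_x (`|support_fun Z (e x)| + 1) + 1).
  by rewrite ltr_wpDl // sumr_ge0 // => x _; rewrite addr_ge0.
move=> N A hA near; rewrite exchange_big /= ler_wpDr // ler_sum // => x _.
have := near (e x) (delta_unit_sphere R x.1.1.1); rewrite ler_norml => /andP[_].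
rewrite lerBlDl => h; apply: le_trans (lerD (ler_norm _) (lexx _)).
apply: le_trans h; apply: ler_sum => j _.
have -> : lincomb (e x) (A j) = A j x.1.1.1.
  rewrite /lincomb (bigD1 x.1.1.1) //= big1 ?addr0.
    by rewrite mxE !eqxx scale1r.
  by move=> i /negPf ix; rewrite mxE eqxx ix scale0r.
by case: x => [[[i j'] k] r]; exact: ler_coord_trace_norm.
Qed.

Lemma expectation_of_operanoid :
  exists (A : 'I_d -> R -> 'M[R[i]]_m),
    random_hermitian_tuple (A : 'I_d -> measurableTypeR R -> _) /\
    (\int[unit_unif R]_w (Num.sqrt (\sum_(i < d) frob2 (A i w)))%:E < +oo)%E /\
    forall u : 'rV[R]_d, unit_sphere d u ->
      (support_fun Z u)%:E =
      (\int[unit_unif R]_w (trace_norm (lincomb u (fun i => A i w)))%:E)%E.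
Proof.
have [C C0 hC] := mass_bound.
have inv_gt0 n : 0 < n.+1%:R^-1 :> R by rewrite invr_gt0.
pose approx n := cid (operanoid_approx (inv_gt0 n)).
have [N [B hB]] : exists (N : nat -> nat) (B : forall n, 'I_(N n) -> 'I_d -> 'M[R[i]]_m),
    forall n, (forall j i, Defs.hermitian (B n j i)) /\
    forall u, unit_sphere d u ->
      `|\sum_(j < N n) trace_norm (lincomb u (B n j)) - support_fun Z u| <= n.+1%:R^-1.
  exists (fun n => sval (approx n)), (fun n => sval (cid (svalP (approx n)))) => n.
  exact: (svalP (cid (svalP (approx n)))).
pose a n j : coord d m -> R := coord_of (B n j).
pose s n j : R := \sum_x `|a n j x|.
have s0 n j : 0 <= s n j by exact: sumr_ge0.
have sC n : \sum_j s n j <= C.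
  apply: hC; first exact: (hB n).1.
  by move=> u su; rewrite (le_trans ((hB n).2 u su)) // invf_le1 ?ler1n.
have a0 n j x : s n j = 0 -> a n j x = 0.
  move=> /eqP; rewrite psumr_eq0 // => /allP/(_ x (mem_index_enum _)).
  by rewrite normr_eq0 => /eqP.
have as_le n j x : `|a n j x| <= s n j.
  by rewrite /s (bigD1 x) //= lerDl sumr_ge0.
(* Atom [j] gets mass [s n j / C] and is rescaled by [C / s n j]: this puts it in the box of radius
   [C] and, by homogeneity, preserves its contribution. [None] carries the missing mass at 0, where
   [tnorm] vanishes. *)
pose I n : finType := option 'I_(N n).
pose p n (o : I n) : R :=
  if o is Some j then s n j / C else 1 - \sum_j s n j / C.
pose v n (o : I n) : coord d m -> R :=
  if o is Some j then fun x => C / s n j * a n j x else fun=> 0.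
have p0 n o : 0 <= p n o.
  case: o => [j|]; first by rewrite /p divr_ge0 // ltW.
  by rewrite /p subr_ge0 -mulr_suml ler_pdivrMr // mul1r.
have p1 n : \sum_o p n o = 1 by rewrite sum_option /p subrK.
have vC n o : in_box C (v n o).
  move=> x; case: o => [j|] /=; last by rewrite normr0 ltW.
  rewrite !normrM normfV (ger0_norm (s0 n j)) (gtr0_norm C0) -mulrA ler_piMr ?(ltW C0) //.
  have [s_eq0|sn0] := eqVneq (s n j) 0; first by rewrite s_eq0 invr0 mul0r.
  by rewrite mulrC ler_pdivrMr ?mul1r // lt0r sn0 s0.
have pv n u : \sum_o p n o * tnorm u (v n o) = \sum_j trace_norm (lincomb u (B n j)).
  rewrite sum_option /= tnorm0 mulr0 add0r; apply: eq_bigr => j _.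
  have <- : tnorm u (a n j) = trace_norm (lincomb u (B n j)).
    by rewrite /tnorm coord_ofK //; exact: (hB n).1.
  rewrite tnormZ ger0_norm ?divr_ge0 // ?ltW //.
  (* If [s n j = 0], the rescaling factor is 0 by the convention on inverses, but then [a n j]
     itself vanishes. *)
  have [s_eq0|sn0] := eqVneq (s n j) 0.
    rewrite (_ : a n j = fun=> 0) ?tnorm0 ?mulr0 //.
    by apply/funext => x; exact: a0.
  by rewrite mulrA (_ : s n j / C * (C / s n j) = 1) ?mul1r //; field; rewrite sn0 gt_eqF.
have [X [mX bX hX]] := weak_limit (ltW C0) p0 p1 vC.
have hA : random_hermitian_tuple (fun i (w : measurableTypeR R) => herm_of (X w) i).
  split; first by move=> i w; exact: herm_of_hermitian.
  move=> i j k; split; under eq_fun do rewrite mxE /=; apply: measurable_funM => //.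
    by apply: measurable_funD; exact: mX.
  by apply: measurable_funB; exact: mX.
exists (fun i w => herm_of (X w) i); split=> //; split.
  (* The coordinates of [X] are bounded by [C + 1], so the Frobenius norm is bounded by a constant,
     which is integrable. *)
  pose Q : R := \sum_(i < d) \sum_(j < m) \sum_(k < m) ((C + 1) ^+ 2 + (C + 1) ^+ 2).
  apply: (@le_lt_trans _ _ (\int[unit_unif R]_w (Num.sqrt Q)%:E)%E); last first.
    rewrite integral_cst //.
    rewrite [X in (_ * X)%E](_ : _ = 1%E) ?mule1 ?ltry //.
    exact: (probability_setT (unit_unif R)).
  apply: ge0_le_integral => //.
  - by apply/measurable_EFinP; exact: measurable_frob_norm hA.
  - move=> w _; rewrite lee_fin ler_wsqrtr // ler_sum // => i _.
    rewrite frob2E; last exact: herm_of_hermitian.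
    apply: ler_sum => j _; apply: ler_sum => k _; rewrite !mxE /=.
    have sq z : `|z| <= C + 1 -> z ^+ 2 <= (C + 1) ^+ 2.
      move=> zS; rewrite -(real_normK (num_real z)) ler_pXn2r ?nnegrE //.
      by rewrite addr_ge0 // ltW.
    have := bX w (i, j, k, true); have := bX w (i, k, j, true).
    have := bX w (i, j, k, false); have := bX w (i, k, j, false).
    rewrite !ler_norml => /andP[? ?] /andP[? ?] /andP[? ?] /andP[? ?].
    by apply: lerD; apply: sq; rewrite ler_norml; apply/andP; split; lra.
move=> u su; apply/esym; apply: (hX (tnorm u) (lip_cst R d m)).
- exact: lip_cst_ge0.
- exact: tnorm_ge0.
- by move=> b c; exact: tnorm_lipschitz.
apply/cvgrPdist_le => e e0; have [k hk] : exists k : nat, k.+1%:R^-1 <= e.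
  exists (Num.trunc e^-1); rewrite -[leRHS]invrK lef_pV2 ?posrE ?invr_gt0 //.
  exact/ltW/truncnS_gt.
exists k => // n /= kn; rewrite distrC pv (le_trans ((hB n).2 u su)) //.
by rewrite (le_trans _ hk) // lef_pV2 ?posrE // ler_nat.
Qed.

End OperanoidToExpectation.
End Operanoids.

Theorem mainTheorem1 (R : realType) (d m : nat) (Z : set 'rV[R]_d) :
  convex_body Z -> (forall x, Z x -> Z (- x)) -> (0 < m)%N ->
  operanoid m Z <->
  exists (dsp : measure_display) (Omega : measurableType dsp)
         (P : probability Omega R) (A : 'I_d -> Omega -> 'M[R[i]]_m),
    random_hermitian_tuple A /\
    (\int[P]_w (Num.sqrt (\sum_(i < d) frob2 (A i w)))%:E < +oo)%E /\
    forall u : 'rV[R]_d, unit_sphere d u ->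
      (support_fun Z u)%:E = (\int[P]_w (trace_norm (lincomb u (fun i => A i w)))%:E)%E.
Proof.
move=> cZ sZ _; split.
  move=> /(expectation_of_operanoid cZ sZ)[A [hA [iA ZA]]].
  by exists _, (measurableTypeR R), (unit_unif R), A.
move=> [dsp [T [P [A [hA [iA ZA]]]]]].
exact: (operanoid_of_expectation cZ sZ hA iA ZA).
Qed.
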